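(* Let $n$ be a positive integer. Every $\mathbf{X}\in\mathcal{P}_n$ has big Ramsey degree in $\mathcal{P}_n$ equal to $\tan^{(2|\mathbf{X}|-1)}(0)$; that is, $\tan^{(2|\mathbf{X}|-1)}(0)$ is the least natural number $L$ such that for every natural $k>0$, every map $\chi:\binom{\mathbb{Q}_n}{\mathbf{X}}\to\{0,\dots,k-1\}$ admits $\widetilde{\mathbf{Q}}\in\binom{\mathbb{Q}_n}{\mathbb{Q}_n}$ on which $\chi$ takes at most $L$ values on $\binom{\widetilde{\mathbf{Q}}}{\mathbf{X}}$.
   Context: $\mathcal{P}_n$ is the class of all finite structures $\mathbf{A}=(A,<^{\mathbf{A}},P_1^{\mathbf{A}},\dots,P_n^{\mathbf{A}})$ where $<^{\mathbf{A}}$ is a linear order on $A$ and $\{P_1^{\mathbf{A}},\dots,P_n^{\mathbf{A}}\}$ is a partition of $A$ into disjoint sets (some possibly empty); isomorphisms are order-preserving bijections $f$ with $x\in P_i^{\mathbf{A}}\iff f(x)\in P_i^{\mathbf{B}}$. $\mathbb{Q}_n=(\mathbb{Q},<,Q_1,\dots,Q_n)$ where $<$ is the usual order of the rationals and $Q_1,\dots,Q_n$ is a partition of $\mathbb{Q}$ into dense subsets (the unique countable homogeneous structure whose finite substructures form $\mathcal{P}_n$). For structures $\mathbf{X},\mathbf{Z}$ of this type, $\binom{\mathbf{Z}}{\mathbf{X}}$ is the set of substructures of $\mathbf{Z}$ isomorphic to $\mathbf{X}$. $\tan^{(m)}(0)$ is the $m$-th derivative of $\tan$ at $0$. *)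

(* Defs.v *)
From HB Require Import structures.
From mathcomp Require Import all_boot all_order all_algebra.
From mathcomp Require Import all_classical all_reals all_analysis.
Set Implicit Arguments. Unset Strict Implicit. Unset Printing Implicit Defensive.
Import Order.TTheory GRing.Theory Num.Theory.
Local Open Scope ring_scope.

(* A structure (A,<,P_1..P_n) in P_n, up to isomorphism, is the word over
   'I_n obtained by listing the colours (index of the part) of the elements
   of A in increasing order.  |X| = size X. *)
Definition Pn (n : nat) := seq 'I_n.

(* Q_n = (rat, <, Q_1..Q_n) : c x is the index of the part containing x;
   every part is dense. *)
Definition dense_partition (n : nat) (c : rat -> 'I_n) : Prop :=
  forall (i : 'I_n) (x y : rat), x < y -> exists z : rat, x < z /\ z < y /\ c z = i.

(* A copy of X inside Q_n: a finite subset of rat whose induced structure is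
   isomorphic to X; represented by its increasing enumeration s. *)
Definition copy_of (n : nat) (c : rat -> 'I_n) (X : Pn n) (s : seq rat) : Prop :=
  sorted (fun x y : rat => x < y) s /\ map c s = X.

(* A substructure of Q_n isomorphic to Q_n: the image of an order- and
   colour-preserving injection f : rat -> rat. *)
Definition self_embedding (n : nat) (c : rat -> 'I_n) (f : rat -> rat) : Prop :=
  (forall x y : rat, x < y -> f x < f y) /\ (forall x : rat, c (f x) = c x).

Definition big_ramsey_bound (n : nat) (c : rat -> 'I_n) (X : Pn n) (L : nat) : Prop :=
  forall (k : nat), (0 < k)%N -> forall chi : seq rat -> 'I_k,
    exists f : rat -> rat, self_embedding c f /\
      exists V : {set 'I_k}, (#|V| <= L)%N /\
        forall s : seq rat, copy_of c X s -> all (fun x => x \in range f) s ->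
          chi s \in V.

Definition big_ramsey_degree_is (n : nat) (c : rat -> 'I_n) (X : Pn n) (L : nat) : Prop :=
  big_ramsey_bound c X L /\ forall L' : nat, big_ramsey_bound c X L' -> (L <= L')%N.

(* Main.v *)
(** Fix the enumeration of the rationals by [pickle].  Each rational
    [z] contributes, at successive times, the cuts [z <= _] and [z < _] and then
    ends.  Two rationals [x < y] are split at the time of the first cut separating
    them.  Recording, for a finite increasing tuple, the order in which its
    members are split and ended gives its history: a sequence of steps, each of
    which deletes one of the current cells or splits it in two, leading from one
    cell to none.  If [W N k] is the number of histories with [N] steps starting
    from [k] cells, then [W (N + 1) k = k (W N (k + 1) + W N (k - 1))], which is
    also the recursion for the value at [0] of the [N]-th derivative of [tan^k],
    because [tan' = 1 + tan^2].

    Lower bound: every history is realised, with any prescribed colours, inside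
    the range of any self-embedding, by successively shrinking intervals; so the
    history is a colouring all of whose values persist.

    Upper bound: read a rational as the word recording its side of the successive
    cuts, so that a tuple becomes a word of columns.  The order in which the
    columns first occur depends only on the history and on [X].  By the dual
    Ramsey theorem for finite words (Carlson-Simpson) there is a rigid
    substitution after which the colour of a word depends only on the number of
    its distinct letters, once these are numbered by first occurrence; composing it with
    an order- and colour-preserving map from words to the rationals yields a
    self-embedding on which the colour depends only on the history.  The
    Carlson-Simpson theorem is proved with an idempotent ultrafilter on words
    that start with the variable, chosen so that all its instances lie in one
    minimal left ideal of ultrafilters on constant words. *)

Require Import Defs.
From HB Require Import structures.
From mathcomp Require Import all_boot all_order all_algebra.
From mathcomp Require Import all_classical all_reals all_analysis.
From mathcomp Require Import zify.
Import Order.TTheory GRing.Theory Num.Theory.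
Local Open Scope ring_scope.
Set Implicit Arguments. Unset Strict Implicit. Unset Printing Implicit Defensive.

(** * Ultrafilters on free monoids *)

Section Ultrafilters.
Local Open Scope nat_scope.
Local Open Scope classical_set_scope.

(** Zorn's lemma is applied to the sets [A] for which [F] united with [A] is a proper filter
    satisfying [Q]; the empty chain is then bounded because [F] itself qualifies. *)
Lemma maximal_proper_filter (T : Type) (Q : set_system T -> Prop)
    (F : set_system T) :
    ProperFilter F -> Q F ->
    (forall C : set (set_system T), C !=set0 -> total_on C subset ->
      (forall X, C X -> ProperFilter X) -> C `<=` Q -> Q (\bigcup_(X in C) X)) ->
  exists G, [/\ ProperFilter G, Q G, F `<=` G &
    forall H, ProperFilter H -> Q H -> G `<=` H -> H = G].
Proof.
move=> PF QF Qchain.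
pose P (A : set_system T) := ProperFilter (F `|` A) /\ Q (F `|` A).
have [A [[PA QA] Amax]] : exists A, P A /\ forall B, A `<` B -> ~ P B.
  apply: Zorn_bigcup => C CP Ctot.
  have [->|/set0P [X0 CX0]] := eqVneq C set0.
    by rewrite bigcup_set0 /P setU0.
  pose D := [set F `|` X | X in C].
  have DE : F `|` \bigcup_(X in C) X = \bigcup_(Y in D) Y.
    apply/seteqP; split=> [U [FU|[X CX XU]]|U [_ [X CX <-]] [FU|XU]].
    - by exists (F `|` X0); [exists X0|left].
    - by exists (F `|` X); [exists X|right].
    - by left.
    - by right; exists X.
  have D0 : D !=set0 by exists (F `|` X0), X0.
  have Dtot : total_on D subset.
    by move=> _ _ [X CX <-] [Y CY <-]; case: (Ctot X Y CX CY) => XY;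
      [left|right]; apply: setUS.
  rewrite /P DE; split; last by apply: Qchain => // _ [X /CP [PX QX] <-].
  have DP Y : D Y -> ProperFilter Y by case=> X /CP [PX _] <-.
  have [Y0 DY0] := D0.
  split.
    by case=> Y DY Ye; have YP := DP Y DY; exact: (filter_not_empty Y).
  split.
  - by exists Y0 => //; have YP := DP _ DY0; apply: filterT.
  - move=> U V [Y DY YU] [Z DZ ZV].
    have YP := DP Y DY; have ZP := DP Z DZ.
    case: (Dtot Y Z DY DZ) => YZ.
      by exists Z => //; apply: filterI => //; apply: YZ.
    by exists Y => //; apply: filterI => //; apply: YZ.
  - move=> U V UV [Y DY YU]; exists Y => //.
    by have YP := DP Y DY; apply: filterS YU.
exists (F `|` A); split=> // H PH QH AH.
have FH : F `<=` H by move=> U FU; apply: AH; left.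
have HE : F `|` H = H by apply/setUidPr.
apply/seteqP; split=> // U HU; right.
apply: contrapT => nAU; apply: (Amax H); last by rewrite /P HE.
by split=> [V AV|HA]; [apply: AH; right|apply/nAU/HA].
Qed.

Lemma properI (T : Type) (F : set_system T) (A B : set T) :
  ProperFilter F -> F A -> F B -> A `&` B !=set0.
Proof. by move=> PF FA FB; exact: (filter_ex (filterI FA FB)). Qed.

Lemma ultra_setC (T : Type) (u : set_system T) (A : set T) :
  UltraFilter u -> ~ u A -> u (~` A).
Proof. by move=> Uu nA; case: (in_ultra_setVsetC A Uu). Qed.

Lemma ultra_fmap (T U : Type) (f : T -> U) (u : set_system T) :
  UltraFilter u -> UltraFilter (f @ u).
Proof.
move=> Uu; split; first exact: fmap_proper_filter.
move=> G PG uG; apply/seteqP; split=> // P GP /=; apply: contrapT => nP.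
have /uG nGP : (f @ u) (~` P) by apply: (ultra_setC (A := f @^-1` P)).
by have [t []] := properI _ GP nGP.
Qed.

Lemma filter_all_seq (T : Type) (I : eqType) (F : set_system T) (s : seq I)
    (P : I -> set T) :
  Filter F -> (forall i, i \in s -> F (P i)) ->
  F [set t | forall i, i \in s -> P i t].
Proof.
move=> FF; elim: s => [|i s IH] H; first by apply: filterS filterT.
have H1 := H i (mem_head i s).
have H2 : F [set t | forall j, j \in s -> P j t].
  by apply: IH => j js; apply: H; rewrite inE js orbT.
apply: filterS (filterI H1 H2) => t [Pi Ps] j; rewrite inE.
by case/orP => [/eqP ->|]; [|apply: Ps].
Qed.

Lemma ultra_color (T : Type) (C : finType) (f : T -> C) (u : set_system T) :
  UltraFilter u -> exists c, u [set t | f t = c].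
Proof.
move=> Uu; apply: contrapT => H.
have H' c : u (~` [set t | f t = c]).
  by apply: ultra_setC => uc; apply: H; exists c.
have [t Ht] := filter_ex (filter_all_seq _ (fun c _ => H' c) : u [set t | forall c, c \in enum C -> _]).
by apply: (Ht (f t)) => //; rewrite mem_enum.
Qed.

End Ultrafilters.

Section IdempotentUltrafilters.
Local Open Scope nat_scope.
Local Open Scope classical_set_scope.
Variable X : Type.
Implicit Types (P Q : set (seq X)) (F G u : set_system (seq X)) (s t : seq X).

(* [fun P => F (derived G P)] is the product of [F] and [G] that extends
   concatenation to filters. *)
Definition derived G P := [set s | G [set t | P (s ++ t)]].

Lemma derivedI G P Q : Filter G ->
  derived G (P `&` Q) = derived G P `&` derived G Q.
Proof.
move=> FG; apply/seteqP; split=> s /=.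
  move=> H; split; apply: filterS H => t [] //.
by move=> [H1 H2]; apply: filterS (filterI H1 H2).
Qed.

Lemma derivedS G P Q : Filter G -> P `<=` Q -> derived G P `<=` derived G Q.
Proof. by move=> FG PQ s; apply: filterS => t /PQ. Qed.

Lemma derivedC u P : UltraFilter u -> derived u (~` P) = ~` derived u P.
Proof.
move=> Uu; apply/seteqP; split=> s /=.
  by move=> H1 H2; have [t []] := properI _ H1 H2.
by move=> H; apply: ultra_setC Uu H.
Qed.

Lemma derived_shift G P s :
  derived G [set t | P (s ++ t)] = [set t | derived G P (s ++ t)].
Proof.
by apply/funext => t; congr (G _); apply/funext => w; rewrite /= catA.
Qed.

Lemma proper_product F G : ProperFilter F -> ProperFilter G ->
  ProperFilter [set P | F (derived G P)].
Proof.
move=> PF PG; split.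
  move=> /= H; have [s Hs] := filter_ex H.
  by apply: (filter_not_empty G); apply: filterS Hs.
split=> /=.
- by apply: filterS (@filterT _ F _) => s _; apply: filterS (@filterT _ G _).
- by move=> P Q FP FQ; rewrite /= derivedI; apply: filterI.
- by move=> P Q PQ; apply: filterS; apply: derivedS.
Qed.

(* Ellis' lemma: the hypothesis says that the ultrafilters containing [F0] form a
   closed subsemigroup of the Stone-Cech compactification, so that a maximal
   filter with this property plays the role of a minimal closed subsemigroup. *)
Lemma idempotent_ultrafilter F0 : ProperFilter F0 ->
  (forall P, F0 P -> F0 (derived F0 P)) ->
  exists u, [/\ UltraFilter u, F0 `<=` u & forall P, u P -> u (derived u P)].
Proof.
move=> PF0 idF0.
have [|F [PF idF F0F Fmax]] := @maximal_proper_filter _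
  (fun G => forall P, G P -> G (derived G P)) F0 PF0 idF0.
  move=> C _ _ CP CQ P [Y CY YP]; exists Y => //.
  have PY : Filter Y by apply: CP.
  by apply: filterS (CQ _ CY _ YP) => s Ys; exists Y.
have [u [Uu Fu]] := ultraFilterLemma PF.
exists u; split=> //; first exact: subset_trans Fu.
(* Read filters as closed sets of ultrafilters: [F] is a minimal closed subsemigroup [S], [u] is a
   point of it, and [Fu'] is [S u]. Minimality gives [S u = S]. *)
pose Fu' := [set P | F (derived u P)].
have PFu : ProperFilter Fu' by exact: proper_product.
have FFu : F `<=` Fu'.
  move=> P FP; apply: filterS (idF _ FP) => s; exact: Fu.
have Fu'E : Fu' = F.
  apply: Fmax => // P FB.
  have -> : derived Fu' P = derived F (derived u P).
    by apply/funext => s; rewrite {1}/derived /Fu' /= derived_shift.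
  exact/FFu/idF.
(* [G] stands for the set of [q] in [S] with [q u = u]. It is nonempty because [S u = S], and again
   a closed subsemigroup; so it is all of [S] and contains [u]. *)
pose G := [set Q | exists B P, [/\ F B, u P & B `&` derived u P `<=` Q]].
have PG : ProperFilter G.
  split.
    move=> [B [P [FB uP BP]]].
    have : Fu' (~` P).
      rewrite /Fu' /= derivedC; apply: filterS FB => s Bs Ps; exact: (BP s).
    rewrite Fu'E => /Fu uNP.
    by have [t []] := properI _ uP uNP.
  split.
  - by exists setT, setT; split=> //; apply: filterT.
  - move=> Q R [B [P [FB uP BP]]] [B' [P' [FB' uP' BP']]].
    exists (B `&` B'), (P `&` P'); split; [exact: filterI|exact: filterI|].
    by rewrite derivedI => s [[Bs B's] [Ps P's]]; split; [apply: BP|apply: BP'].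
  - move=> Q R QR [B [P [FB uP BP]]]; exists B, P; split=> //.
    exact: subset_trans QR.
have GE : G = F.
  apply: Fmax => //.
    move=> Q [B [P [FB uP BP]]]; exists (derived F B), P; split=> //.
      exact: idF.
    move=> s [Bs Ps]; exists [set t | B (s ++ t)], [set t | P (s ++ t)].
    by split=> //; rewrite derived_shift => t [Bt Pt]; apply: BP.
  by move=> B FB; exists B, setT; split=> //; apply: filterT.
by move=> P uP; apply: Fu; rewrite -GE; exists setT, P; split=> //; apply: filterT.
Qed.
End IdempotentUltrafilters.

(** * The Carlson-Simpson theorem for left-variable words *)

Section CarlsonSimpson.
Local Open Scope nat_scope.
Local Open Scope classical_set_scope.

(* Words over [N] letters are lists of naturals [< N]; the letter [N] itself is
   used as the variable. *)
Definition subst (N a : nat) (y : seq nat) := [seq if i == N then a else i | i <- y].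

Definition left_variable N (y : seq nat) :=
  exists2 y', y = N :: y' & all (gtn N.+1) y'.

Lemma subst_cat N a y z : subst N a (y ++ z) = subst N a y ++ subst N a z.
Proof. exact: map_cat. Qed.

Lemma subst_id N a y : all (gtn N) y -> subst N a y = y.
Proof.
move=> /allP yN; rewrite -[RHS]map_id; apply/eq_in_map => i /yN /= iN.
by rewrite ltn_eqF.
Qed.

Lemma all_subst N a y : a < N -> all (gtn N.+1) y -> all (gtn N) (subst N a y).
Proof.
move=> aN /allP yN; rewrite all_map; apply/allP => i /yN /=.
by rewrite ltnS leq_eqVlt; case: eqP => // _.
Qed.

(** The instances of [v] are idempotents of one minimal left ideal, in which each idempotent is a
    right identity. Hence a word that keeps its colour under almost all extensions can be prolonged
    by every instance of a common variable word without losing this property. That each [y i] begins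
    with the variable later yields rigidity. *)
Lemma carlson_simpson N (C : finType) (f : seq nat -> C) : 0 < N ->
  exists z (y : nat -> seq nat) col,
    [/\ all (gtn N) z, forall i, left_variable N (y i) &
    forall a, all (gtn N) a ->
    f (z ++ flatten [seq subst N (nth 0 a i) (y i) | i <- iota 0 (size a)]) = col].
Proof.
move=> N0; pose A : set (seq nat) := [set w | all (gtn N) w].
pose F0 : set_system (seq nat) := [set P | A `<=` P].
have PF0 : ProperFilter F0.
  split; first by move=> /(_ [::]); apply.
  split; first by move=> ?.
    by move=> P Q AP AQ w Aw; split; [apply: AP|apply: AQ].
  by move=> P Q PQ AP; apply: subset_trans PQ.
(* A maximal filter invariant under left translation by constant words corresponds to a minimal left
   ideal of ultrafilters on constant words. *)
have [||F [PF invF F0F Fmax]] := @maximal_proper_filter _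
  (fun G => forall P s, G P -> A s -> G [set t | P (s ++ t)]) F0 PF0.
- by move=> P s AP As t At; apply: AP; rewrite /A /= all_cat [all _ s]As.
- by move=> G _ _ _ Ginv P s [Y GY YP] As; exists Y => //; exact: (Ginv Y GY).
have FA : F A by apply: F0F.
(* If [L] is the ideal, [L p] is a left ideal inside [L], hence equal to [L]; so [q = r p] for some
   [r] in [L], and [q p = r p p = q]. *)
have right_identity q p : UltraFilter q -> UltraFilter p -> F `<=` q -> F `<=` p ->
    (forall P, p P -> p (derived p P)) -> forall P, q P -> q (derived p P).
  move=> Uq Up Fq Fp idp P qP; apply: contrapT => nqP.
  have Fp_sub : F `<=` [set P | F (derived p P)].
    by move=> Q FQ; apply: filterS FA => s As; apply: Fp; apply: invF.
  have FpE : [set P | F (derived p P)] = F.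
    apply: Fmax => //; first exact: proper_product.
    by move=> Q s FQ As; rewrite /= derived_shift; apply: invF.
  pose R := P `&` ~` derived p P.
  have qR : q R by apply: filterI => //; apply: ultra_setC.
  have : F (derived p (~` R)).
    apply: filterS FA => s _; rewrite derivedC /R derivedI derivedC => -[].
    by move=> sP; apply; have := idp _ sP; rewrite derived_shift.
  by rewrite -[F _]/([set P | F (derived p P)] _) FpE => /Fq nR; have [t []] := properI _ qR nR.
have [u [Uu Fu]] := ultraFilterLemma PF.
pose J := [set y | left_variable N y].
have J_cat s t : J s -> all (gtn N.+1) t -> J (s ++ t).
  by move=> [s' -> s'N] tN; exists (s' ++ t) => //; rewrite all_cat s'N.
have AS t : A t -> all (gtn N.+1) t.
  by move=> /allP At; apply/allP => i /At /= /ltnW.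
(* [G] is the intersection of the ultrafilters [s u] over left-variable words [s]. As [u] lives on
   constant words, an instance of [s u] is a constant word times [u], so it lies in the left
   ideal. *)
pose G : set_system (seq nat) := [set Q | forall s, J s -> u [set t | Q (s ++ t)]].
have uA : u A := Fu _ FA.
have GJ : G J by move=> s Js; apply: filterS uA => t /AS; apply: J_cat.
have PG : ProperFilter G.
  split.
    have JN : J [:: N] by exists [::].
    by move=> /(_ _ JN) => H; exact: (filter_not_empty u H).
  split.
  - by move=> s _; apply: filterT.
  - by move=> P Q GP GQ s Js; apply: filterS (filterI (GP s Js) (GQ s Js)).
  - by move=> P Q PQ GP s Js; apply: filterS (GP s Js) => t /PQ.
have [|v [Uv Gv idv]] := @idempotent_ultrafilter _ G PG.
  move=> P GP; suff JP : J `<=` derived G P by exact: (filterS JP GJ).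
  move=> s Js t Jt; rewrite /=.
  have -> : [set w | P (s ++ (t ++ w))] = [set w | P ((s ++ t) ++ w)].
    by apply/funext => w; rewrite /= catA.
  by apply/GP/J_cat => //; case: Jt => t' -> /= ->; rewrite ltnSn.
pose p a : set_system (seq nat) := subst N a @ v.
have Up a : UltraFilter (p a) by apply: ultra_fmap.
have Fp a : a < N -> F `<=` p a.
  move=> aN B FB; apply: (Gv (subst N a @^-1` B)) => s [s' -> s'N].
  have As : A (subst N a (N :: s')) by apply: all_subst => //=; rewrite ltnSn.
  apply: filterS (filterI uA (Fu _ (invF _ _ FB As))) => t [At Bt].
  by rewrite /preimage /mkset subst_cat (subst_id a At).
have idp a P : p a P -> p a (derived (p a) P).
  rewrite -[p a P]/(v (subst N a @^-1` P)) => vP.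
  rewrite -[p a _]/(v [set s | v [set t | P (subst N a s ++ subst N a t)]]).
  apply: filterS (idv _ vP) => s.
  by apply: filterS => t; rewrite /preimage /mkset subst_cat.
have RI a b P : a < N -> b < N -> p a P -> p a (derived (p b) P).
  by move=> aN bN; apply: right_identity => //; [apply: Fp|apply: Fp|apply: idp].
have [col uP] := ultra_color f Uu.
set P := [set t | f t = col] in uP.
(* The words of colour [col] that keep this colour under [p a]-almost every extension, for each
   letter [a]. *)
pose Ps := [set s | [/\ A s, P s & forall a, a \in iota 0 N -> p a [set t | P (s ++ t)]]].
have uPs : u Ps.
  have H : u [set s | forall a, a \in iota 0 N -> derived (p a) P s].
    apply: filter_all_seq => a; rewrite mem_iota => /= aN.
    by apply: right_identity => //; [apply: Fp|apply: idp].
  by apply: filterS (filterI uA (filterI uP H)) => s [? []].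
have vPs s a : Ps s -> a < N -> v [set y | Ps (s ++ subst N a y)].
  move=> [As sP sa] aN; rewrite -[v _]/(p a [set t | Ps (s ++ t)]).
  have H : p a [set t | forall b, b \in iota 0 N -> p b [set w | P (s ++ (t ++ w))]].
    apply: filter_all_seq => b; rewrite mem_iota => /= bN.
    apply: (RI a b [set w | P (s ++ w)]) => //.
    by apply: sa; rewrite mem_iota.
  have Pa : p a [set t | P (s ++ t)] by apply: sa; rewrite mem_iota.
  apply: filterS (filterI (Fp a aN _ FA) (filterI Pa H)) => t [At [Pt tb]].
  split=> //; first by rewrite /A /= all_cat [all _ s]As.
  by move=> b /tb; congr (p b _); apply/funext => w; rewrite /= catA.
(* One [y] has to serve all words of the finite list [S], because the next variable word may not
   depend on the letters substituted earlier. *)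
have ext (S : seq (seq nat)) : exists y, (forall s, s \in S -> Ps s) ->
    J y /\ forall s a, s \in S -> a < N -> Ps (s ++ subst N a y).
  have [HS|nS] := pselect (forall s, s \in S -> Ps s); last by exists [::] => /nS.
  have : v [set y | forall s, s \in S -> forall a, a \in iota 0 N -> Ps (s ++ subst N a y)].
    apply: filter_all_seq => s /HS sP; apply: filter_all_seq => a.
    by rewrite mem_iota => /= aN; apply: vPs.
  move=> /(filterI (Gv _ GJ)) /filter_ex [y [Jy Hy]]; exists y => _; split=> // s a sS aN.
  by apply: Hy => //; rewrite mem_iota.
have [g gP] := choice ext.
have [z zPs] := filter_ex uPs.
pose fix S m := if m is m'.+1 then
  [seq s ++ subst N a (g (S m')) | s <- S m', a <- iota 0 N] else [:: z].
have SP m s : s \in S m -> Ps s.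
  elim: m s => [|m IH] s /=; first by rewrite inE => /eqP ->.
  move=> /allpairsP [[t a] /= [tS aN ->]].
  by have [_] := gP _ IH; apply => //; rewrite mem_iota in aN.
exists z, (g \o S), col; split.
- by case: zPs.
- by move=> i; have [] := gP _ (SP i).
move=> a aN.
suff /SP [] : z ++ flatten [seq subst N (nth 0 a i) ((g \o S) i) | i <- iota 0 (size a)]
   \in S (size a) by [].
have: forall m, m <= size a -> z ++ flatten [seq subst N (nth 0 a i) ((g \o S) i) | i <- iota 0 m]
   \in S m.
  elim=> [|m IH] ma; first by rewrite /= cats0 mem_head.
  rewrite -addn1 iotaD add0n map_cat flatten_cat /= cats0 catA addn1.
  apply/allpairsP; exists (z ++ flatten [seq subst N (nth 0 a i) ((g \o S) i) | i <- iota 0 m], nth 0 a m).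
  split=> //=; first by apply: IH; apply: ltnW.
  by rewrite mem_iota /= add0n; move/allP: aN; apply; apply: mem_nth.
exact.
Qed.
End CarlsonSimpson.

(** * The dual Ramsey theorem for finite words *)

Section DualRamsey.
Local Open Scope nat_scope.

(** [undup] keeps last occurrences; the two reversals make it keep the first ones, in order. *)
Definition firsts (T : eqType) (s : seq T) := rev (undup (rev s)).

Lemma firsts_rcons (T : eqType) (s : seq T) x :
  firsts (rcons s x) = if x \in s then firsts s else rcons (firsts s) x.
Proof. by rewrite /firsts rev_rcons /= mem_rev; case: ifP => // _; rewrite rev_cons. Qed.

Lemma mem_firsts (T : eqType) (s : seq T) : firsts s =i s.
Proof. by move=> x; rewrite mem_rev mem_undup mem_rev. Qed.

Lemma firsts_uniq (T : eqType) (s : seq T) : uniq (firsts s).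
Proof. by rewrite rev_uniq undup_uniq. Qed.

Lemma firsts_cat_sub (T : eqType) (s t : seq T) : {subset t <= s} ->
  firsts (s ++ t) = firsts s.
Proof.
elim/last_ind: t => [|t x IH] ts; first by rewrite cats0.
rewrite -rcons_cat firsts_rcons mem_cat ts ?mem_rcons ?mem_head //=.
by apply: IH => y yt; apply: ts; rewrite mem_rcons inE yt orbT.
Qed.

Lemma firsts_map_inj (T U : eqType) (f : T -> U) (s : seq T) :
  {in s &, injective f} -> firsts (map f s) = map f (firsts s).
Proof.
elim/last_ind: s => //= s x IH inj.
have inj' : {in s &, injective f}.
  by move=> y z ys zs; apply: inj; rewrite mem_rcons inE ?ys ?zs orbT.
rewrite map_rcons !firsts_rcons IH //.
have -> : (f x \in map f s) = (x \in s).
  apply/idP/idP => [/mapP [y ys fxy]|]; last exact: map_f.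
  by rewrite (inj x y) ?mem_rcons ?mem_head // inE ys orbT.
by case: ifP => // _; rewrite map_rcons.
Qed.

(* A rigid surjection of [omega] onto itself is described by the words [F n] it
   takes strictly before its first occurrence of [n]. *)
Definition rigid (F : nat -> seq nat) :=
  F 0 = [::] /\
  forall n, all (gtn n) (F n) /\ prefix (rcons (F n) n) (F n.+1).

(** A word [t] is a map on the positions below [size t]; this is its composite with the rigid
    surjection, read up to the first occurrence of [size t]. *)
Definition app (T : Type) (x0 : T) (F : nat -> seq nat) (t : seq T) :=
  [seq nth x0 t i | i <- F (size t)].

Definition comp (F G : nat -> seq nat) n := app 0 F (G n).

Section Application.
Variables (F : nat -> seq nat) (rF : rigid F).

Lemma rigid_lt n i : i \in F n -> i < n.
Proof. by have [/allP H _] := rF.2 n; apply: H. Qed.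

Lemma rigid_prefix m n : m <= n -> prefix (F m) (F n).
Proof.
move=> /subnK <-; elim: (n - m) => [|k IH]; first exact: prefix_refl.
apply: prefix_trans IH _; rewrite addSn.
exact: prefix_trans (prefix_rcons _ _) (rF.2 _).2.
Qed.

Lemma app_map (T U : Type) (x0 : T) (y0 : U) (g : T -> U) (t : seq T) :
  app y0 F (map g t) = map g (app x0 F t).
Proof.
rewrite /app size_map -map_comp; apply/eq_in_map => i /rigid_lt it /=.
exact: nth_map.
Qed.

Lemma app_sub (T : eqType) (x0 : T) (t : seq T) : {subset app x0 F t <= t}.
Proof. by move=> x /mapP [i /rigid_lt it ->]; apply: mem_nth. Qed.

Lemma app_cat (T : Type) (x0 : T) (t u : seq T) :
  exists w, app x0 F (t ++ u) = app x0 F t ++ w.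
Proof.
have /prefixP [w Hw] : prefix (F (size t)) (F (size (t ++ u))).
  by apply: rigid_prefix; rewrite size_cat leq_addr.
exists [seq nth x0 (t ++ u) i | i <- w]; rewrite /app Hw map_cat; congr (_ ++ _).
by apply/eq_in_map => i /rigid_lt it; rewrite nth_cat it.
Qed.

Lemma app_rcons (T : Type) (x0 : T) (t : seq T) x :
  exists w, app x0 F (rcons t x) = rcons (app x0 F t) x ++ w.
Proof.
have /prefixP [w Hw] := (rF.2 (size t)).2.
exists [seq nth x0 (rcons t x) i | i <- w]; rewrite /app size_rcons Hw map_cat.
congr (_ ++ _); rewrite map_rcons nth_rcons ltnn eqxx; congr rcons.
by apply/eq_in_map => i /rigid_lt it; rewrite nth_rcons it.
Qed.

Lemma mem_app (T : eqType) (x0 : T) (t : seq T) : app x0 F t =i t.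
Proof.
move=> x; apply/idP/idP; first exact: app_sub.
elim/last_ind: t => // t y IH; have [w ->] := app_rcons x0 t y.
rewrite mem_cat !mem_rcons !inE => /orP [->//|/IH ->].
by rewrite orbT.
Qed.

Lemma firsts_app (T : eqType) (x0 : T) (t : seq T) : firsts (app x0 F t) = firsts t.
Proof.
elim/last_ind: t => [|t x IH]; first by rewrite /app rF.1.
have [w Hw] := app_rcons x0 t x; rewrite Hw firsts_cat_sub.
  by rewrite !firsts_rcons IH mem_app.
move=> y yw; have : y \in app x0 F (rcons t x) by rewrite Hw mem_cat yw orbT.
by rewrite mem_app !mem_rcons !inE mem_app.
Qed.

End Application.

Lemma app_comp (T : Type) (x0 : T) F G t : rigid F -> rigid G ->
  app x0 (comp F G) t = app x0 F (app x0 G t).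
Proof.
move=> rF rG; rewrite {1}/app /comp.
rewrite -(app_map rF 0 x0 (nth x0 t) (G (size t))); congr (app x0 F _).
Qed.

Lemma rigid_comp F G : rigid F -> rigid G -> rigid (comp F G).
Proof.
move=> rF rG; split; first by rewrite /comp rG.1 /app rF.1.
move=> n; split.
  by apply/allP => i; rewrite /comp mem_app // => /(rigid_lt rG).
have /prefixP [w Hw] := (rG.2 n).2.
rewrite /comp Hw; have [w' ->] := app_cat rF 0 (rcons (G n) n) w.
have [w'' ->] := app_rcons rF 0 (G n) n.
by rewrite -catA prefix_prefix.
Qed.

Lemma rigid_iota : rigid (iota 0).
Proof.
split=> // n; split; first by apply/allP => i; rewrite mem_iota.
by rewrite -addn1 iotaD cats1 prefix_refl.
Qed.

Lemma app_iota_small (T : Type) (x0 : T) F (t : seq T) :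
  F (size t) = iota 0 (size t) -> app x0 F t = t.
Proof. by rewrite /app => ->; rewrite map_nth_iota0 // take_size. Qed.

(** The letters of the Carlson-Simpson theorem are here the [n.+1] positions of [rcons t k], so that
    one application serves all [t] of length [n] simultaneously. *)
Lemma stabilize_step (C : finType) (chi : seq nat -> C) (k n : nat) V : rigid V ->
  exists U, [/\ rigid U, forall j, j <= n -> U j = iota 0 j &
    forall t u, size t = n -> all (gtn k) t -> {subset u <= rcons t k} ->
      chi (app 0 V (app 0 U (rcons t k ++ u))) =
      chi (app 0 V (app 0 U (rcons t k)))].
Proof.
move=> rV.
pose f (z : seq nat) : {ffun n.-tuple 'I_k -> C} :=
  [ffun t : n.-tuple 'I_k => chi (app 0 V [seq nth 0 (rcons (map val t) k) i | i <- iota 0 n.+1 ++ z])].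
have [z [y [col [zN yN Hf]]]] := carlson_simpson f (ltn0Sn n).
pose W m := z ++ flatten [seq subst n.+1 (n.+1 + i) (y i) | i <- iota 0 m].
(* [U] lists the first [n.+1] numbers, then [z], then the words [y i] with the variable replaced by
   the fresh number [n.+1 + i]. As [y i] begins with the variable, each fresh number appears where
   rigidity demands it. *)
pose U j := if j <= n then iota 0 j else iota 0 n.+1 ++ W (j - n.+1).
have WS m : W m.+1 = W m ++ subst n.+1 (n.+1 + m) (y m).
  by rewrite /W -[m.+1]addn1 iotaD map_cat flatten_cat /= cats0 catA.
have W_lt m : all (gtn (n.+1 + m)) (W m).
  elim: m => [|m IH]; first by rewrite addn0 /W cats0.
  rewrite WS all_cat addnS; apply/andP; split.
    by apply/allP => i /(allP IH) /= /ltnW.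
  have [y' -> /allP y'N] := yN m; apply/allP => i /mapP [l ly ->] /=.
  case: eqP => [_|/eqP ln]; first by rewrite ltnS.
  have lN : l < n.+2.
    by move: ly; rewrite inE => /orP [/eqP ->|/y'N].
  rewrite ltnS; apply: leq_trans (leq_addr _ _).
  by move: lN; rewrite ltnS.
have US j : n < j -> U j = iota 0 n.+1 ++ W (j - n.+1).
  by move=> nj; rewrite /U leqNgt nj.
have rU : rigid U.
  split=> // j; split.
    case: (leqP j n) => jn; first by rewrite /U jn; apply/allP => i; rewrite mem_iota.
    rewrite US // all_cat; apply/andP; split; last first.
      by have := W_lt (j - n.+1); rewrite subnKC.
    by apply/allP => i; rewrite mem_iota /= => iN; apply: leq_trans iN _.
  case: (ltngtP j n) => jn.
  - by rewrite /U jn ltnW //; case: (rigid_iota.2 j).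
  - rewrite !US // ?ltnS ?(ltnW jn) // subSn // WS; have [y' -> _] := yN (j - n.+1).
    have -> : subst n.+1 (n.+1 + (j - n.+1)) (n.+1 :: y') =
              [:: j] ++ subst n.+1 (n.+1 + (j - n.+1)) y' by rewrite /= eqxx subnKC.
    by rewrite -cats1 !catA prefix_prefix.
  - rewrite jn (US n.+1) // subnn /U leqnn -cats1 -[[:: n]]/(iota (0 + n) 1).
    by rewrite -iotaD addn1 prefix_prefix.
exists U; split=> //; first by move=> j jn; rewrite /U jn.
move=> t u tn tk utk.
pose a := [seq index i (rcons t k) | i <- u].
have aN : all (gtn n.+1) a.
  by apply/allP => i /mapP [l /utk lt ->]; move: lt; rewrite /= -index_mem size_rcons tn.
have uE : u = [seq nth 0 (rcons t k) i | i <- a].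
  rewrite -map_comp -[LHS]map_id; apply/eq_in_map => i /utk iu /=.
  by rewrite nth_index.
have UE b : all (gtn n.+1) b ->
    app 0 U (rcons t k ++ [seq nth 0 (rcons t k) i | i <- b]) =
    [seq nth 0 (rcons t k) i | i <- iota 0 n.+1 ++
      (z ++ flatten [seq subst n.+1 (nth 0 b i) (y i) | i <- iota 0 (size b)])].
  move=> bN; have tE : rcons t k = [seq nth 0 (rcons t k) i | i <- iota 0 n.+1].
    by rewrite map_nth_iota0 ?size_rcons ?tn // take_oversize // size_rcons tn.
  rewrite {1}tE -map_cat (app_map rU 0); congr map.
  have low l : l < n.+1 -> nth 0 (iota 0 n.+1 ++ b) l = l.
    by move=> lN; rewrite nth_cat size_iota lN nth_iota.
  have high l : nth 0 (iota 0 n.+1 ++ b) (n.+1 + l) = nth 0 b l.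
    by rewrite nth_cat size_iota ltnNge leq_addr addKn.
  rewrite /app size_cat size_iota US ?leq_addr // addKn map_cat.
  move: (iota 0 n.+1 ++ b) low high => s0 low high; congr (_ ++ _).
    rewrite -[RHS]map_id; apply/eq_in_map => l; rewrite mem_iota => /andP [_].
    exact: low.
  rewrite map_cat; congr (_ ++ _).
    by rewrite -[RHS]map_id; apply/eq_in_map => l /(allP zN); apply: low.
  rewrite map_flatten -map_comp; congr flatten; apply/eq_in_map => i _ /=.
  have [y' -> /allP y'N] := yN i; rewrite /subst -map_comp.
  apply/eq_in_map => l ly /=; case: eqP => [_|/eqP ln]; first exact: high.
  have lN : l < n.+2 by move: ly; rewrite inE => /orP [/eqP ->|/y'N].
  by apply: low; rewrite ltn_neqAle ln.
have [t' t'E] : exists t' : n.-tuple 'I_k, map val t' = t.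
  have st : size t == n by apply/eqP.
  have nk (i : 'I_n) : nth 0 t i < k by apply: (allP tk); apply: mem_nth; rewrite tn.
  exists [tuple Ordinal (nk i) | i < n].
  rewrite -map_comp; apply: (@eq_from_nth _ 0); first by rewrite size_map size_enum_ord.
  move=> i; rewrite size_map size_enum_ord => iN.
  by rewrite (nth_map (Ordinal iN)) ?size_enum_ord //= nth_enum_ord.
have chiE b : all (gtn n.+1) b ->
    chi (app 0 V (app 0 U (rcons t k ++ [seq nth 0 (rcons t k) i | i <- b]))) = col t'.
  by move=> bN; rewrite UE // -(Hf b bN) ffunE t'E.
by rewrite uE chiE // -[in RHS](cats0 (rcons t k)) -[[::] in RHS]/(map (nth 0 (rcons t k)) [::]) chiE.
Qed.

(* Fusion: the [n]-th step leaves the words of length at most [n] unchanged, so the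
   steps have a diagonal limit. *)
Lemma stabilize (C : finType) (chi : seq nat -> C) (k : nat) :
  exists2 V, rigid V & forall t u, all (gtn k) t -> {subset u <= rcons t k} ->
    chi (app 0 V (rcons t k ++ u)) = chi (app 0 V (rcons t k)).
Proof.
have step (nV : nat * (nat -> seq nat)) : exists U, rigid nV.2 ->
   [/\ rigid U, forall j, j <= nV.1 -> U j = iota 0 j &
    forall t u, size t = nV.1 -> all (gtn k) t -> {subset u <= rcons t k} ->
      chi (app 0 nV.2 (app 0 U (rcons t k ++ u))) =
      chi (app 0 nV.2 (app 0 U (rcons t k)))].
  have [/(stabilize_step chi k nV.1) [U HU]|nr] := pselect (rigid nV.2).
    by exists U.
  by exists (iota 0) => /nr.
have [g gP] := choice step.
pose fix V n := if n is m.+1 then comp (V m) (g (m, V m)) else iota 0.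
have rV n : rigid (V n).
  elim: n => [|n IH]; first exact: rigid_iota.
  by apply: rigid_comp => //; case: (gP (n, V n) IH).
have VS n t : app 0 (V n.+1) t = app 0 (V n) (app 0 (g (n, V n)) t).
  by rewrite app_comp //; case: (gP (n, V n) (rV n)).
have Vstable n m : n <= m -> V m n = V n n.
  move=> /subnK <-; elim: (m - n) => [//|i IH]; rewrite -IH addSn /= /comp.
  have [_ Uj _] := gP (i + n, V (i + n)) (rV _).
  rewrite (Uj n (leq_addl _ _)) /app size_iota; apply: (@eq_from_nth _ 0); rewrite ?size_map // => l lV.
  rewrite (nth_map 0) // nth_iota //; exact: (rigid_lt (rV _)) (mem_nth _ lV).
pose Vw n := V n n.
have Vw_app (t : seq nat) n : size t <= n -> app 0 Vw t = app 0 (V n) t.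
  by move=> tn; rewrite /app /Vw -(Vstable _ n tn).
have rVw : rigid Vw.
  split=> // n; have := (rV n.+1).2 n; rewrite /Vw (Vstable n n.+1) //.
exists Vw => // t u tk utk.
(* The step made at length [size t] gives the equality; each later step fixes [rcons t k] and only
   turns the continuation [u] into another one over the same letters. *)
suff H N : size t < N -> forall u, {subset u <= rcons t k} ->
    chi (app 0 (V N) (rcons t k ++ u)) = chi (app 0 (V (size t).+1) (rcons t k)).
  rewrite (Vw_app _ _ (leqnn _)) (Vw_app (rcons t k) (size t).+1) ?size_rcons //.
  by apply: H => //; rewrite size_cat size_rcons leq_addr.
elim: N => // N IH; rewrite ltnS leq_eqVlt => /orP [/eqP <-|tN] {}u {}utk.
  by rewrite !VS; have [_ _ ->] := gP (size t, V (size t)) (rV _).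
have [rU Uj _] := gP (N, V N) (rV N).
rewrite VS; have [w Hw] := app_cat rU 0 (rcons t k) u.
have UE : app 0 (g (N, V N)) (rcons t k) = rcons t k.
  by apply: app_iota_small; apply: Uj; rewrite size_rcons.
rewrite Hw UE.
apply: IH => // x xw.
have : x \in app 0 (g (N, V N)) (rcons t k ++ u) by rewrite Hw mem_cat xw orbT.
by rewrite mem_app // mem_cat => /orP [//|/utk].
Qed.

Lemma firsts_iotaS (k : nat) (t : seq nat) : firsts t = iota 0 k.+1 ->
  exists t1 t2, [/\ t = rcons t1 k ++ t2, firsts t1 = iota 0 k & {subset t2 <= rcons t1 k}].
Proof.
elim/last_ind: t => // t x IH; rewrite firsts_rcons; case: ifP => xt.
  move=> /[dup] tk /IH [t1 [t2 [tE t1k t2k]]]; exists t1, (rcons t2 x); split=> //.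
    by rewrite tE rcons_cat.
  move=> y; rewrite mem_rcons inE => /orP [/eqP ->|/t2k //].
  by move: xt; rewrite tE mem_cat => /orP [//|/t2k].
rewrite -[k.+1]addn1 iotaD cats1 => /rcons_inj [tk ->].
by exists t, [::]; split; rewrite // cats0.
Qed.

(** Induction on the number of letters: after [stabilize] the colour depends only on the part before
    the first occurrence of the last letter, and this part uses one letter fewer. *)
Theorem dual_ramsey (C : finType) (k : nat) (chi : seq nat -> C) :
  exists V c, rigid V /\ forall t, firsts t = iota 0 k -> chi (app 0 V t) = c.
Proof.
elim: k => [|k IH] in chi *.
  exists (iota 0), (chi [::]); split=> [|t t0]; first exact: rigid_iota.
  by case: t t0 => // x t tx; have := mem_head x t; rewrite -mem_firsts tx.
have [V rV VP] := stabilize chi k.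
have [V' [c [rV' V'P]]] := IH (fun t => chi (app 0 V (rcons t k))).
exists (comp V V'), c; split=> [|t]; first exact: rigid_comp.
move=> /firsts_iotaS [t1 [t2 [-> t1k t2k]]]; rewrite app_comp //.
have [w Hw] := app_cat rV' 0 (rcons t1 k) t2.
have [w' Hw'] := app_rcons rV' 0 t1 k.
have lt1 i : i \in t1 -> i < k by rewrite -mem_firsts t1k mem_iota.
rewrite Hw Hw' -catA VP; first exact: V'P.
  by apply/allP => i; rewrite mem_app // => /lt1.
move=> x xw.
have : x \in app 0 V' (rcons t1 k ++ t2).
  by rewrite Hw Hw' -catA mem_cat xw orbT.
rewrite mem_app // mem_cat !mem_rcons !inE mem_app // => /orP [//|/t2k].
by rewrite mem_rcons.
Qed.

Theorem dual_ramsey_lt (C : finType) (K : nat) (chi : seq nat -> C) :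
  exists V (c : nat -> C), rigid V /\
    forall k t, k < K -> firsts t = iota 0 k -> chi (app 0 V t) = c k.
Proof.
elim: K => [|K [V [c [rV VP]]]].
  by exists (iota 0), (fun=> chi [::]); split=> //; exact: rigid_iota.
have [V' [c' [rV' V'P]]] := dual_ramsey K (fun t => chi (app 0 V t)).
exists (comp V V'), (fun k => if k == K then c' else c k); split.
  exact: rigid_comp.
move=> k t; rewrite ltnS app_comp // => kK tk; case: eqP => [kE|/eqP nk].
  by apply: V'P; rewrite tk kE.
by apply: VP; rewrite ?firsts_app // ltn_neqAle nk.
Qed.

End DualRamsey.

(** * Tangent numbers *)

Section TangentNumbers.
Import numFieldNormedType.Exports.
Local Open Scope classical_set_scope.

(* The number of ways of emptying a collection of [k] cells in [N] steps, each
   step either deleting a cell or splitting it in two. *)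
Fixpoint histories_count (N k : nat) : nat :=
  if N is N'.+1 then k * (histories_count N' k.+1 + histories_count N' k.-1)
  else k == 0.

(** Differentiation as it acts on polynomials in [tan], because [tan' = 1 + tan^2]. *)
Definition tan_poly (R : comNzRingType) (p : {poly R}) : {poly R} :=
  (1 + 'X^2) * p^`().

(** The operator sends ['X^k] to [k] times ['X^(k+1) + 'X^(k-1)], and the final evaluation at [0]
    keeps only the exponent [0]. *)
Lemma iter_tan_polyXn (R : comNzRingType) (N k : nat) :
  (iter N (@tan_poly R) 'X^k).[0] = (histories_count N k)%:R.
Proof.
have iterD M (p q : {poly R}) :
    iter M (@tan_poly R) (p + q) = iter M (@tan_poly R) p + iter M (@tan_poly R) q.
  elim: M p q => // M IH p q; rewrite !iterSr -IH; congr iter.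
  by rewrite /tan_poly derivD mulrDr.
have iterMn M (p : {poly R}) j :
    iter M (@tan_poly R) (p *+ j) = iter M (@tan_poly R) p *+ j.
  elim: M p => // M IH p; rewrite !iterSr -IH; congr iter.
  by rewrite /tan_poly derivMn mulrnAr.
elim: N k => [|N IH] k; first by rewrite /= hornerXn expr0n.
rewrite iterSr /tan_poly derivXn mulrnAr mulrDl mul1r -exprD iterMn iterD.
case: k => [|k]; first by rewrite mulr0n horner0.
by rewrite hornerMn hornerD !IH -natrD -mulr_natl -natrM addnC.
Qed.

Lemma cos_neq0_near (R : realType) (x : R) : cos x != 0 ->
  \forall y \near x, cos y != 0.
Proof.
move=> cx.
have : open [set y : R | cos y != 0].
  apply: (@open_comp _ _ _ [set y | y != 0]); last exact: open_neq.
  by move=> y _; exact: continuous_cos.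
by move=> cx_open; apply: open_nbhs_nbhs.
Qed.

Lemma derive1n_tan (R : realType) (N : nat) (x : R) : cos x != 0 ->
  derive1n N (@tan R) x = (iter N (@tan_poly R) 'X).[tan x].
Proof.
elim: N x => [|N IH] x cx; first by rewrite /= hornerX.
set p := iter N (@tan_poly R) 'X.
(* The induction hypothesis holds only where [cos] does not vanish, so the two functions are
   compared near [x]. *)
rewrite derive1nS derive1E.
have -> : 'D_1 (derive1n N (@tan R)) x = 'D_1 (horner p \o @tan R) x.
  apply: near_eq_derive; near=> y; rewrite /= IH //.
  by near: y; exact: cos_neq0_near.
have dp : is_derive (tan x) 1 (horner p) (p^`()).[tan x].
  by apply: DeriveDef; [exact: derivable_horner|rewrite derivE derive1E].
have dt := is_derive_tan cx.
have [_ ->] := is_derive1_comp dp dt.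
by rewrite cos2_tan2 // /tan_poly /= hornerM !hornerE mulrC.
Unshelve. all: by end_near. Qed.

Lemma derive1n_tan0 (R : realType) (N : nat) :
  derive1n N (@tan R) 0 = (histories_count N 1)%:R.
Proof. by rewrite derive1n_tan ?cos0 ?oner_eq0 // tan0 -iter_tan_polyXn. Qed.

End TangentNumbers.

(** * Embedding countable coloured orders in the rationals *)

Section Embedding.

Lemma rat_above (V : seq rat) : exists y, all (fun w => w < y) V.
Proof.
elim: V => [|v V [y yV]]; first by exists 0.
exists (Num.max v y + 1); rewrite /= ltr_pwDr ?le_max ?lexx //=.
by apply: sub_all yV => w /= wy; rewrite ltr_pwDr // le_max (ltW wy) orbT.
Qed.

Lemma rat_between (x : rat) (V : seq rat) : all (fun w => w > x) V ->
  exists2 y, x < y & all (fun w => w >= y) V.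
Proof.
elim: V => [|v V IH] /= => [_|/andP [xv /IH [y xy yV]]].
  by exists (x + 1) => //; rewrite ltrDl.
exists (Num.min v y); first by rewrite lt_min xv.
rewrite ge_min lexx /=; apply: sub_all yV => w /=; apply: le_trans.
by rewrite ge_min lexx orbT.
Qed.

Lemma color_between (n : nat) (c : rat -> 'I_n) (L U : seq rat) (i : 'I_n) :
  dense_partition c -> (forall l u, l \in L -> u \in U -> l < u) ->
  exists z, [/\ c z = i, all (fun w => w < z) L & all (fun w => w > z) U].
Proof.
move=> cd LU.
have [x xL xU] : exists2 x, all (fun w => w <= x) L & all (fun w => w > x) U.
  elim: L LU => [|l L IH] LU.
    have [y /allP yU] := rat_above (map -%R U); exists (- y) => //.
    by apply/allP => u uU; rewrite /= ltrNl; apply: yU; apply: map_f.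
  have [l' u l'L uU|x xL xU] := IH; first by apply: LU; rewrite // inE l'L orbT.
  exists (Num.max l x).
    rewrite /= le_max lexx /=; apply: sub_all xL => w wx.
    by rewrite le_max wx orbT.
  apply/allP => u uU; rewrite /= gt_max (allP xU) // LU ?mem_head //.
have [y xy /allP yU] := rat_between xU.
have [z [xz [zy cz]]] := cd i x y xy.
exists z; split=> //; first by apply: sub_all xL => w /= wx; apply: le_lt_trans xz.
by apply/allP => u /yU; apply: lt_le_trans.
Qed.

(** The forth half of a back-and-forth argument: at each stage finitely many values are given, and
    density of the colours supplies the next one. *)
Lemma colored_embedding_nat (n : nat) (c : rat -> 'I_n) (lt : rel nat)
    (col : nat -> 'I_n) : dense_partition c -> irreflexive lt -> transitive lt ->
  exists e : nat -> rat, (forall i j, lt i j -> e i < e j) /\ forall i, c (e i) = col i.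
Proof.
move=> cd lt_irr lt_tr.
pose below (s : seq rat) := [seq nth 0 s i | i <- iota 0 (size s) & lt i (size s)].
pose above (s : seq rat) := [seq nth 0 s i | i <- iota 0 (size s) & lt (size s) i].
have ext (s : seq rat) : exists z,
    (forall l u, l \in below s -> u \in above s -> l < u) ->
    [/\ c z = col (size s), all (fun w => w < z) (below s) & all (fun w => w > z) (above s)].
  have [H|nH] := pselect (forall l u, l \in below s -> u \in above s -> l < u).
    by have [z Hz] := color_between (col (size s)) cd H; exists z.
  by exists 0 => /nH.
have [g gP] := choice ext.
pose fix st m := if m is m'.+1 then rcons (st m') (g (st m')) else [::].
pose e i := g (st i).
have size_st m : size (st m) = m by elim: m => //= m IH; rewrite size_rcons IH.
have st_nth m i : (i < m)%N -> nth 0 (st m) i = e i.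
  elim: m => // m IH; rewrite ltnS leq_eqVlt /= nth_rcons size_st.
  by case: ltngtP => //= [im _|-> //]; exact: IH.
have belowP m x : reflect (exists2 i, (i < m)%N & lt i m /\ x = e i) (x \in below (st m)).
  rewrite /below size_st; apply: (iffP mapP) => [[i]|[i im [lim ->]]].
    by rewrite mem_filter mem_iota => /andP [lim im] ->; exists i; rewrite ?st_nth.
  by exists i; rewrite ?st_nth // mem_filter lim mem_iota.
have aboveP m x : reflect (exists2 i, (i < m)%N & lt m i /\ x = e i) (x \in above (st m)).
  rewrite /above size_st; apply: (iffP mapP) => [[i]|[i im [lim ->]]].
    by rewrite mem_filter mem_iota => /andP [lim im] ->; exists i; rewrite ?st_nth.
  by exists i; rewrite ?st_nth // mem_filter lim mem_iota.
have main m : (forall i j, (i < m)%N -> (j < m)%N -> lt i j -> e i < e j) ->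
    [/\ c (e m) = col m, forall i, (i < m)%N -> lt i m -> e i < e m &
     forall i, (i < m)%N -> lt m i -> e m < e i].
  move=> IH; have [|cz /allP zl /allP zu] := gP (st m).
    move=> _ _ /belowP [i im [li ->]] /aboveP [j jm [lj ->]].
    by apply: IH => //; apply: lt_tr lj.
  split; first by rewrite -[in RHS](size_st m).
    by move=> i im li; apply: zl; apply/belowP; exists i.
  by move=> i im li; apply: zu; apply/aboveP; exists i.
have all_lt m : forall i j, (i < m)%N -> (j < m)%N -> lt i j -> e i < e j.
  elim: m => // m IH i j; have [_ Hl Hu] := main m IH.
  rewrite !ltnS leq_eqVlt => /orP [/eqP ->|im]; rewrite leq_eqVlt => /orP [/eqP ->|jm].
  - by rewrite lt_irr.
  - exact: Hu.
  - exact: Hl.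
  - exact: IH.
exists e; split=> [i j|i]; last by case: (main i (all_lt i)).
by apply: (all_lt (maxn i j).+1); rewrite ltnS leq_max leqnn ?orbT.
Qed.

Lemma colored_embedding (T : countType) (n : nat) (c : rat -> 'I_n) (lt : rel T)
    (col : T -> 'I_n) : (0 < n)%N ->
  dense_partition c -> irreflexive lt -> transitive lt ->
  exists e : T -> rat, (forall x y, lt x y -> e x < e y) /\ forall x, c (e x) = col x.
Proof.
move=> n0 cd lt_irr lt_tr.
pose ltn i j := if (unpickle i, unpickle j) is (Some x, Some y) then lt x y else false.
have [i|j i k|e [eL ec]] := @colored_embedding_nat n c ltn
    (fun i => if unpickle i is Some x then col x else Ordinal n0) cd.
- by rewrite /ltn; case: unpickle.
- rewrite /ltn; case: (unpickle i) => [x|//]; case: (unpickle j) => [y|//].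
  by case: (unpickle k) => [z|//]; exact: lt_tr.
exists (e \o pickle); split=> [x y xy|x] /=; last by rewrite ec pickleK.
by apply: eL; rewrite /ltn !pickleK.
Qed.

End Embedding.

(** * Histories *)

Section Histories.
Local Open Scope nat_scope.

(** [(true, i)] records the splitting of cell [i], and [(false, i)] its deletion. *)
Fixpoint histories (N k : nat) : seq (seq (bool * nat)) :=
  if N is N'.+1 then
    [seq (true, i) :: h | i <- iota 0 k, h <- histories N' k.+1] ++
    [seq (false, i) :: h | i <- iota 0 k, h <- histories N' k.-1]
  else if k == 0 then [:: [::]] else [::].

Lemma size_histories N k : size (histories N k) = histories_count N k.
Proof.
elim: N k => [|N IH] k /=; first by case: eqP.
by rewrite size_cat !size_allpairs size_iota !IH mulnDr.
Qed.

Lemma histories_uniq N k : uniq (histories N k).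
Proof.
elim: N k => [|N IH] k /=; first by case: eqP.
have inj (b : bool) : injective (fun p : nat * seq (bool * nat) => (b, p.1) :: p.2).
  by move=> [i h] [j g] /= [-> ->].
rewrite cat_uniq !allpairs_uniq ?iota_uniq //=; last 2 first.
- by move=> [i h] [j g] _ _ /= [-> ->].
- by move=> [i h] [j g] _ _ /= [-> ->].
rewrite andbT; apply/hasPn => _ /allpairsP [[i h] /= [_ _ ->]].
by apply/negP => /allpairsP [[j g] /= [_ _]].
Qed.

(** A cell lists the times of its remaining events. The least time overall is the next event: either
    it is alone in its cell, which ends, or it cuts its cell into the parts on its left and
    right. *)
Inductive history_of : seq (seq nat) -> seq (bool * nat) -> Prop :=
| HistoryNil : history_of [::] [::]
| HistoryEnd A B v h : history_of (A ++ B) h ->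
    all (ltn v) (flatten (A ++ B)) ->
    history_of (A ++ [:: v] :: B) ((false, size A) :: h)
| HistorySplit A B l r v h : history_of (A ++ l :: r :: B) h ->
    all (ltn v) (flatten (A ++ l :: r :: B)) ->
    history_of (A ++ (l ++ v :: r) :: B) ((true, size A) :: h).

Lemma history_ofP W h0 : history_of W h0 ->
  if h0 is e :: h then
    exists A B l r v, [/\ W = A ++ (l ++ v :: r) :: B, e.2 = size A,
      all (ltn v) (flatten A ++ l ++ r ++ flatten B) &
      if e.1 then history_of (A ++ l :: r :: B) h
      else [/\ l = [::], r = [::] & history_of (A ++ B) h]]
  else W = [::].
Proof.
case=> [//|A B v h H H'|A B l r v h H H'].
  by exists A, B, [::], [::], v; rewrite flatten_cat in H'.
by exists A, B, l, r, v; rewrite flatten_cat in H'.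
Qed.

(** Distinguishes ends from splits: a lone time cannot be a split, since the halves would be empty
    cells. *)
Lemma history_of_nonempty W h : history_of W h -> [::] \notin W.
Proof.
elim: h W => [|e h IH] W /history_ofP; first by move=> ->.
move=> [A [B [l [r [v [-> _ _]]]]]]; rewrite mem_cat inE.
have -> : ([::] == l ++ v :: r) = false by case: l.
case: e.1 => [/IH|[_ _ /IH]]; rewrite !mem_cat ?inE !negb_or.
  by case/and3P => -> _ /andP [].
by [].
Qed.

Lemma mem_histories W h : history_of W h -> h \in histories (size (flatten W)) (size W).
Proof.
elim: h W => [|[b i] h IH] W /history_ofP; first by move=> ->.
move=> [A [B [l [r [v [-> /= -> _ H]]]]]].
have Ai G : size A \in iota 0 (size (A ++ G :: B)).
  by rewrite mem_iota size_cat /= addnS ltnS leq_addr.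
have -> : size (flatten (A ++ (l ++ v :: r) :: B)) =
    (size (flatten A ++ (l ++ r) ++ flatten B)).+1.
  by rewrite flatten_cat /= !size_cat /= addnS addSn addnS.
rewrite /= mem_cat; case: b H => [/IH H|[-> -> /IH H]]; apply/orP; [left|right].
  apply/allpairsP; exists (size A, h); split=> //=.
  by move: H; rewrite flatten_cat /= !size_cat /= !addnS !addnA.
apply/allpairsP; exists (size A, h); split=> //=.
by move: H; rewrite flatten_cat !size_cat /= addnS.
Qed.

Definition same_order (a b : seq nat) :=
  forall p q, p \in zip a b -> q \in zip a b -> (p.1 <= q.1) = (p.2 <= q.2).

Lemma mem_zip (T U : eqType) (s : seq T) (t : seq U) p :
  p \in zip s t -> p.1 \in s /\ p.2 \in t.
Proof.
elim: s t => [|x s IH] [|y t] //=; rewrite !inE => /orP [/eqP -> /=|/IH [-> ->]].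
  by rewrite !eqxx.
by rewrite !orbT.
Qed.

Lemma same_order_insert a1 a2 b1 b2 v w : size a1 = size b1 ->
  same_order (a1 ++ a2) (b1 ++ b2) ->
  all (ltn v) (a1 ++ a2) -> all (ltn w) (b1 ++ b2) ->
  same_order (a1 ++ v :: a2) (b1 ++ w :: b2).
Proof.
move=> s1 ab /allP va /allP wb.
have mz p : p \in zip (a1 ++ v :: a2) (b1 ++ w :: b2) ->
    p = (v, w) \/ p \in zip (a1 ++ a2) (b1 ++ b2).
  rewrite !zip_cat //= !mem_cat inE => /or3P [->|/eqP ->|->];
  by [right|left|right; rewrite orbT].
move=> p q /mz [->|pz] /mz [->|qz] /=; last exact: ab.
- by rewrite !leqnn.
- by have [/va /ltnW -> /wb /ltnW ->] := mem_zip qz.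
- by have [/va /= H1 /wb /= H2] := mem_zip pz; rewrite leqNgt H1 leqNgt H2.
Qed.

(** Read backwards, a history inserts at each step a new least time at a prescribed place, which
    fixes the relative order of all times. *)
Lemma history_of_order W W' h : history_of W h -> history_of W' h ->
  map size W = map size W' /\ same_order (flatten W) (flatten W').
Proof.
elim: h W W' => [|e h IH] W W' /history_ofP + /history_ofP.
  by move=> -> ->.
move=> [A [B [l [r [v [-> eA vmin H]]]]]] [A' [B' [l' [r' [v' [-> eA' vmin' H']]]]]].
have sA : size A = size A' by rewrite -eA.
have flE (X Y : seq (seq nat)) (s t : seq nat) x :
    flatten (X ++ (s ++ x :: t) :: Y) = (flatten X ++ s) ++ x :: t ++ flatten Y.
  by rewrite flatten_cat /= -!catA.
have fl2E (X Y : seq (seq nat)) (s t : seq nat) :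
    flatten (X ++ s :: t :: Y) = (flatten X ++ s) ++ t ++ flatten Y.
  by rewrite flatten_cat /= -!catA.
have cat_sizes (X Y X' Y' : seq (seq nat)) : size X = size X' ->
    map size (X ++ Y) = map size (X' ++ Y') ->
    map size X = map size X' /\ map size Y = map size Y'.
  move=> sX /eqP; rewrite !map_cat eqseq_cat ?size_map // => /andP [].
  by move=> /eqP -> /eqP ->.
have size_fl (X X' : seq (seq nat)) : map size X = map size X' ->
    size (flatten X) = size (flatten X').
  by rewrite !size_flatten /shape => ->.
rewrite !flE !map_cat /=.
move: H H' vmin vmin'; case: e.1 => [H H'|[-> -> H] [-> -> H']] vmin vmin'; have [sz so] := IH _ _ H H'.
  have [szA /= [szl szr szB]] := cat_sizes _ _ _ _ sA sz.
  rewrite szA szB !size_cat /= szl szr; split=> //.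
  apply: same_order_insert; rewrite -?fl2E ?size_cat ?szl ?(size_fl _ _ szA) //.
  - by move: vmin; rewrite fl2E -!catA.
  - by move: vmin'; rewrite fl2E -!catA.
have [szA szB] := cat_sizes _ _ _ _ sA sz.
rewrite szA szB; split=> //.
by rewrite !cats0; apply: same_order_insert; rewrite -?flatten_cat ?(size_fl _ _ szA) //
  flatten_cat.
Qed.

Lemma cat_cons_unique (A B A' B' : seq (seq nat)) G G' v :
  v \in G -> v \in G' -> v \notin flatten (A ++ B) -> v \notin flatten (A' ++ B') ->
  A ++ G :: B = A' ++ G' :: B' -> [/\ A = A', G = G' & B = B'].
Proof.
have findE (X Y : seq (seq nat)) (H : seq nat) : v \in H -> v \notin flatten (X ++ Y) ->
    find (fun s => v \in s) (X ++ H :: Y) = size X.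
  move=> vH vXY; rewrite find_cat /= vH addn0 ifN //.
  apply: contra vXY => /hasP [s sX vs]; apply/flattenP; exists s => //.
  by rewrite mem_cat sX.
move=> vG vG' vAB vAB' E.
have sA : size A = size A'.
  by rewrite -(findE A B G) // E (findE A' B' G').
by move/eqP: E; rewrite eqseq_cat // => /andP [/eqP -> /eqP [-> ->]].
Qed.

(** The least time is determined, it identifies its cell, and nonemptiness of cells decides between
    end and split; so [W] determines the first step. *)
Lemma history_of_inj W h h' : history_of W h -> history_of W h' -> h = h'.
Proof.
elim: h h' W => [|[b i] h IH] [|[b' i'] h'] W /history_ofP + /history_ofP //.
- by move=> -> [[|? ?] [? [? [? [? []]]]]].
- by move=> [[|? ?] [? [? [? [? [-> _ _ _]]]]]].
move=> [A [B [l [r [v [-> /= -> vmin H]]]]]] [A' [B' [l' [r' [v' [E /= -> vmin' H']]]]]].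
have memE (X Y : seq (seq nat)) (s t : seq nat) x :
    flatten (X ++ (s ++ x :: t) :: Y) =i x :: flatten X ++ s ++ t ++ flatten Y.
  by move=> y; rewrite flatten_cat /= !(mem_cat, inE); case: (y == x);
    case: (y \in flatten X); case: (y \in s); case: (y \in t).
have vv : v = v'.
  apply/eqP; rewrite eqn_leq.
  have : v' \in flatten (A ++ (l ++ v :: r) :: B) by rewrite E memE mem_head.
  rewrite memE inE => /orP [/eqP ->|/(allP vmin) /= /ltnW ->]; first by rewrite leqnn.
  have : v \in flatten (A' ++ (l' ++ v' :: r') :: B') by rewrite -E memE mem_head.
  by rewrite memE inE => /orP [/eqP ->|/(allP vmin') /= /ltnW ->] /=.
rewrite -{v'}vv in E vmin' *.
have nv (X Y : seq nat) s t : all (ltn v) (X ++ s ++ t ++ Y) ->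
   [/\ v \notin X, v \notin Y, v \notin s & v \notin t].
  move=> /allP H0; split; apply/negP => vX; have := H0 v;
  by rewrite !mem_cat vX ?orbT /= ltnn => /(_ isT).
have [vA vB vl vr] := nv _ _ _ _ vmin.
have [vA' vB' vl' vr'] := nv _ _ _ _ vmin'.
have [AA GG BB] : [/\ A = A', l ++ v :: r = l' ++ v :: r' & B = B'].
  apply: (cat_cons_unique (v := v)) E; rewrite ?flatten_cat mem_cat ?negb_or.
  - by rewrite mem_head orbT.
  - by rewrite mem_head orbT.
  - by rewrite vA.
  - by rewrite vA'.
have sl : size l = size l'.
  have : index v (l ++ v :: r) = index v (l' ++ v :: r') by rewrite GG.
  by rewrite !index_cat (negPf vl) (negPf vl') /= eqxx !addn0.
move/eqP: GG; rewrite eqseq_cat // => /andP [/eqP ll /eqP [rr]].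
rewrite -{}AA -{}BB -{}ll -{}rr in H' *.
case: b b' H H' => -[] H H'.
- by rewrite (IH _ _ H H').
- case: H' => l0 r0; move: H; rewrite l0 => /history_of_nonempty.
  by rewrite mem_cat mem_head orbT.
- case: H => l0 r0; move: H'; rewrite l0 => /history_of_nonempty.
  by rewrite mem_cat mem_head orbT.
- by case: H H' => _ _ H [_ _ /(IH _ _ H) ->].
Qed.

End Histories.

(** * Cuts and codes of tuples of rationals *)

Section Codes.
Local Open Scope nat_scope.

(* The rational [z] with [pickle z = r] contributes the cut [z <= _] at time
   [3 r + 2], the cut [z < _] at time [3 r + 3], and ends at time [3 r + 4]. *)
Definition beyond (j : nat) (q : rat) : bool :=
  match j with
  | 0 => false
  | 1 => true
  | j'.+2 => if (unpickle (j' %/ 3) : option rat) is Some z then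
               match j' %% 3 with 0 => (z <= q)%R | 1 => (z < q)%R | _ => false end
             else false
  end.

(** The remainder modulo [3] makes [beyond] false everywhere at this time, so no end coincides with
    a split. *)
Definition end_time (q : rat) := (3 * pickle q).+4.

Definition split_time (x y : rat) :=
  find (fun j => beyond j y && ~~ beyond j x) (iota 0 (end_time x)).

(** The times of all events from left to right, ends alternating with splits of neighbours; removing
    a split time leaves the codes of the two parts. *)
Fixpoint code_from (x : rat) (s : seq rat) : seq nat :=
  if s is y :: s' then [:: end_time x, split_time x y & code_from y s']
  else [:: end_time x].

Definition code (s : seq rat) : seq nat :=
  if s is x :: s' then code_from x s' else [::].

Lemma beyond_le j x y : (x <= y)%R -> beyond j x -> beyond j y.
Proof.
move=> xy; case: j => [|[|j]] //=; case: unpickle => // z.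
by case: (j %% 3) => [|[|//]] zx; [apply: le_trans xy|apply: lt_le_trans xy].
Qed.

Lemma beyond_end_time q x : beyond (end_time q) x = false.
Proof. by rewrite /beyond /end_time -addn2 mulnC divnMDl // modnMDl addn0 pickleK. Qed.

Lemma beyond_ge (q x : rat) : beyond (3 * pickle q).+2 x = (q <= x)%R.
Proof. by rewrite /beyond mulnC mulnK // modnMl pickleK. Qed.

Lemma beyond_gt (q x : rat) : beyond (3 * pickle q).+3 x = (q < x)%R.
Proof. by rewrite /beyond -addn1 mulnC divnMDl // modnMDl addn0 pickleK. Qed.

Lemma end_time_inj : injective end_time.
Proof.
move=> x y [] /eqP; rewrite eqn_mul2l /= => /eqP xy.
exact: (pcan_inj pickleK).
Qed.

Section SplitTime.
Variables (x y : rat) (xy : (x < y)%R).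

Lemma split_time_has : has (fun j => beyond j y && ~~ beyond j x) (iota 0 (end_time x)).
Proof.
apply/hasP; exists (3 * pickle x).+3; first by rewrite mem_iota add0n ltnSn.
by rewrite !beyond_gt xy ltxx.
Qed.

Lemma split_time_lt_end : split_time x y < end_time x.
Proof. by have := split_time_has; rewrite has_find size_iota. Qed.

Lemma beyond_split_time : beyond (split_time x y) y /\ ~~ beyond (split_time x y) x.
Proof.
have := nth_find 0 split_time_has; rewrite -/(split_time x y) nth_iota ?add0n.
  by move=> /andP.
exact: split_time_lt_end.
Qed.

Lemma split_time_le j : beyond j y -> ~~ beyond j x -> split_time x y <= j.
Proof.
move=> jy jx; rewrite leqNgt; apply/negP => jxy.
have := before_find 0 jxy; rewrite nth_iota ?jy ?jx //.
exact: ltn_trans split_time_lt_end.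
Qed.

(** The non-strict cut at [y] is made for this: it separates [y] from everything smaller before [y]
    ends. *)
Lemma split_time_lt_end_right : split_time x y < end_time y.
Proof.
apply: (@leq_ltn_trans (3 * pickle y).+2); last by rewrite /end_time !ltnS leqnSn.
by apply: split_time_le; rewrite beyond_ge -?ltNge ?lexx.
Qed.

End SplitTime.

Lemma code_from_cat x s y t :
  code_from x (s ++ y :: t) = code_from x s ++ split_time (last x s) y :: code_from y t.
Proof. by elim: s x => //= z s IH x; rewrite IH. Qed.

Lemma size_code_from x s : size (code_from x s) = (2 * size s).+1.
Proof. by elim: s x => //= y s IH x; rewrite IH mulnS. Qed.

Lemma size_code s : size (code s) = (2 * size s).-1.
Proof. by case: s => [|x s]; rewrite ?muln0 // size_code_from [size (_ :: _)]/= mulnS. Qed.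

Notation increasing := (sorted (fun x y : rat => (x < y)%R)).

Lemma path_le (x z : rat) s : path (fun x y : rat => (x < y)%R) x s ->
  z \in x :: s -> (x <= z)%R.
Proof.
rewrite (path_sortedE (@lt_trans _ _)) => /andP [/allP xs _].
by rewrite inE => /orP [/eqP ->//|/xs /ltW].
Qed.

Lemma mem_code_from x s v : path (fun x y : rat => (x < y)%R) x s -> v \in code_from x s ->
  [/\ 1 < v, ~~ beyond v x & (exists2 z, z \in x :: s & v = end_time z) \/
     (exists z w, [/\ z \in x :: s, w \in x :: s, ~~ beyond v z & beyond v w])].
Proof.
elim: s x => [|y s IH] x /=.
  rewrite inE => _ /eqP ->; split=> //; first by rewrite beyond_end_time.
  by left; exists x; rewrite ?mem_head.
move=> /andP [xy ys]; rewrite !inE => /or3P [/eqP ->|/eqP ->|].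
- split=> //; first by rewrite beyond_end_time.
  by left; exists x; rewrite ?mem_head.
- have [by1 bx1] := beyond_split_time xy.
  split=> //.
  by right; exists x, y; rewrite !inE !eqxx orbT.
- move=> /(IH _ ys) [v1 vy H]; split=> //.
    by apply: contra vy; apply: beyond_le; apply: ltW.
  case: H => [[z zs ->]|[z [w [zs ws vz vw]]]]; [left|right].
    by exists z => //; rewrite inE zs orbT.
  by exists z, w; split=> //; rewrite inE ?zs ?ws orbT.
Qed.

(** End times carry no cut and are injective in the rational. The split time of [x] and [y] has [y]
    beyond it, which fails for every entry of [code_from y s]. *)
Lemma code_from_uniq x s : path (fun x y : rat => (x < y)%R) x s -> uniq (code_from x s).
Proof.
elim: s x => //= y s IH x /andP [xy ys].
have [b1 b2] := beyond_split_time xy.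
rewrite IH // andbT inE negb_or -!andbA; apply/and3P; split.
- by apply/eqP => E; rewrite -E beyond_end_time in b1.
- apply/negP => /(mem_code_from ys) [_ _ [[z zs /end_time_inj xz]|[z [w [_ _ _]]]]].
    by have := path_le ys zs; rewrite -xz leNgt xy.
  by rewrite beyond_end_time.
- by apply/negP => /(mem_code_from ys) [_]; rewrite b1.
Qed.

Lemma code_min x s v : path (fun x y : rat => (x < y)%R) x s ->
  v \in code_from x s -> {in code_from x s, forall w, v <= w} ->
  (s = [::] /\ v = end_time x) \/
  exists s1 y s2, s = s1 ++ y :: s2 /\ v = split_time (last x s1) y.
Proof.
elim: s x => [|y s IH] x /=; first by rewrite inE => _ /eqP -> _; left.
move=> /andP [xy ys] + vmin; rewrite !inE => /or3P [/eqP vE|/eqP ->|vc].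
- have := vmin (split_time x y); rewrite !inE eqxx orbT => /(_ isT).
  by rewrite vE leqNgt split_time_lt_end.
- by right; exists [::], y, s.
have [w wc||[s1 [z [s2 [-> ->]]]]] := IH y ys vc.
- by apply: vmin; rewrite !inE wc !orbT.
- case=> s0 vE; have := vmin (split_time x y); rewrite !inE eqxx orbT => /(_ isT).
  by rewrite vE leqNgt split_time_lt_end_right.
- by right; exists (y :: s1), z, s2.
Qed.

(** Only the split times between consecutive cells are lost, so distinctness of the times is
    inherited from the whole tuple. *)
Lemma codes_subseq (W : seq (seq rat)) : [::] \notin W ->
  subseq (flatten (map code W)) (code (flatten W)).
Proof.
elim: W => // -[//|x s] W IH; rewrite inE /= => W0.
have := IH W0; case: (flatten W) => [|y t].
  by rewrite subseq0 => /eqP ->; rewrite !cats0.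
rewrite code_from_cat => H; apply: cat_subseq => //.
exact: subseq_trans H (subseq_cons _ _).
Qed.

Lemma seq_min (s : seq nat) : s != [::] -> exists2 v, v \in s & {in s, forall w, v <= w}.
Proof.
elim: s => // x [|y s] IH _.
  by exists x; rewrite ?mem_head // => w; rewrite inE => /eqP ->.
have [//|v vs vmin] := IH.
case: (leqP x v) => xv.
  exists x; first exact: mem_head.
  move=> w; rewrite inE => /orP [/eqP ->//|/vmin]; exact: leq_trans.
exists v; first by rewrite inE vs orbT.
by move=> w; rewrite inE => /orP [/eqP ->|/vmin //]; apply: ltnW.
Qed.

(** Induction on the number of times: by [code_min], removing the least one ends a one-element run
    or splits a run into two nonempty ones. *)
Lemma codes_history (W : seq (seq rat)) : [::] \notin W -> increasing (flatten W) ->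
  exists h, history_of (map code W) h.
Proof.
have [m] := ubnP (size (flatten (map code W))); elim: m W => // m IH W Wm W0 incW.
have [fl0|fl0] := eqVneq (flatten (map code W)) [::].
  exists [::]; case: W fl0 W0 {Wm incW} => [|[|x [|y s]] W] //; constructor.
have [v vW vmin] := seq_min fl0.
have ucodes : uniq (flatten (map code W)).
  apply: subseq_uniq (codes_subseq W0) _.
  by case: (flatten W) incW => // x s; apply: code_from_uniq.
have /flatten_mapP [g gW vg] := vW.
have [i iW gE] : exists2 i, i < size W & nth [::] W i = g.
  by exists (index g W); rewrite ?index_mem ?nth_index.
pose A := take i W; pose B := drop i.+1 W.
have WE : W = A ++ g :: B by rewrite -gE -drop_nth // cat_take_drop.
case: g => [|x s] in vg gW gE WE *; first by [].
move: W0 incW vmin ucodes Wm; rewrite {}WE mem_cat inE negb_or /= => /andP [A0 B0].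
rewrite !flatten_cat !map_cat !flatten_cat /= => incW vmin ucodes Wm.
have xs : path (fun x y : rat => (x < y)%R) x s.
  by have [_] := cat_sorted2 incW; rewrite -cat_cons => /cat_sorted2 [].
have rest l r : code_from x s = l ++ v :: r ->
    all (ltn v) (flatten (map code A) ++ (l ++ r) ++ flatten (map code B)).
  move=> cE; apply/allP => w wW /=; rewrite ltn_neqAle; apply/andP; split; last first.
    apply: vmin; rewrite cE; move: wW; rewrite !mem_cat inE.
    by case/or3P => [->|/orP [->|->]|->]; rewrite ?orbT.
  apply: contraTneq wW => <-; move: ucodes; rewrite cE.
  rewrite (@perm_uniq _ _ (v :: flatten (map code A) ++ (l ++ r) ++ flatten (map code B))).
    by case/andP.
  by apply/permP => p; rewrite /= !count_cat /=; lia.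
have cmin w : w \in code_from x s -> v <= w.
  by move=> wc; apply: vmin; rewrite !mem_cat wc orbT.
case: (code_min xs vg cmin) => [[s0 vE]|[s1 [y [s2 [sE vE]]]]].
  have vAB := rest [::] [::]; rewrite s0 vE in vAB *.
  have [|||h Hh] := IH (A ++ B).
  - by move: Wm; rewrite s0 map_cat flatten_cat !size_cat /=; lia.
  - by rewrite mem_cat negb_or A0 B0.
  - apply: subseq_sorted incW; first exact: lt_trans.
    by rewrite flatten_cat; apply: cat_subseq => //; exact: (suffix_subseq (x :: s)).
  exists ((false, size A) :: h).
  rewrite -(size_map code A); apply: HistoryEnd; first by rewrite -map_cat.
  by rewrite flatten_cat; apply: vAB.
have cE : code_from x s = code (x :: s1) ++ v :: code (y :: s2).
  by rewrite sE code_from_cat vE.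
have [|||h Hh] := IH (A ++ (x :: s1) :: (y :: s2) :: B).
- move: Wm; rewrite cE map_cat flatten_cat /= !size_cat /=.
  by rewrite addnS addSn addnS ltnS -!addnA.
- by rewrite mem_cat !inE negb_or A0 B0.
- by move: incW; rewrite sE flatten_cat /= -!catA.
exists ((true, size A) :: h).
rewrite cE -(size_map code A); apply: HistorySplit; first by move: Hh; rewrite map_cat.
by have := rest _ _ cE; rewrite flatten_cat /= -!catA.
Qed.

End Codes.

Arguments beyond : simpl never.
Arguments end_time : simpl never.
Arguments split_time : simpl never.

(** * Columns of a tuple and their order of first occurrence *)

Section Matrices.
Local Open Scope nat_scope.
Notation increasing := (sorted (fun x y : rat => (x < y)%R)).

Lemma firsts_filter (T : eqType) (U : eqType) (g : T -> U) (keep : pred T) (I : seq T) :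
  (forall I1 p I2, I = I1 ++ p :: I2 -> ~~ keep p ->
    exists2 p', p' \in I1 & keep p' /\ g p' = g p) ->
  firsts (map g I) = firsts (map g [seq p <- I | keep p]).
Proof.
elim/last_ind: I => // I p IH H.
have H' I1 q I2 : I = I1 ++ q :: I2 -> ~~ keep q ->
    exists2 q', q' \in I1 & keep q' /\ g q' = g q.
  by move=> IE; apply: (H I1 q (rcons I2 p)); rewrite IE rcons_cat rcons_cons.
have kept q : q \in I -> exists2 q', q' \in I & keep q' /\ g q' = g q.
  move=> qI; have [kq|nkq] := boolP (keep q); first by exists q.
  have [I1 [I2 IE]] : exists I1 I2, I = I1 ++ q :: I2.
    by case/splitPr: qI => I1 I2; exists I1, I2.
  have [q' q'I1 Hq'] := H' I1 q I2 IE nkq.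
  by exists q' => //; rewrite IE mem_cat q'I1.
have memE y : (y \in map g I) = (y \in map g [seq p <- I | keep p]).
  apply/mapP/mapP => [[q /kept [q' q'I [kq' <-]] ->]|[q]].
    by exists q' => //; rewrite mem_filter kq'.
  by rewrite mem_filter => /andP [_ qI] ->; exists q.
rewrite map_rcons firsts_rcons filter_rcons IH //.
case kp: (keep p); first by rewrite map_rcons firsts_rcons memE.
have [q qI [_ gq]] : exists2 q, q \in I & keep q /\ g q = g p.
  by apply: (H I p [::]); rewrite ?cats1 ?kp.
by rewrite -gq map_f.
Qed.

(* A word is read stage by stage, and stage [T] lists the position [(T, j)] of every
   cut [j <= T] again, so that all columns which an event at time [T] creates occur
   for the first time at stage [T], in an order depending only on the history. *)
Definition positions (N : nat) : seq (nat * nat) :=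
  flatten [seq [seq (T, j) | j <- iota 0 T.+1] | T <- iota 0 N].

Lemma mem_positions N p : (p \in positions N) = (p.1 < N) && (p.2 <= p.1).
Proof.
apply/flatten_mapP/andP => [[T]|[pN pp]].
  by rewrite mem_iota => TN /mapP [j]; rewrite mem_iota => jT -> /=.
exists p.1; rewrite ?mem_iota //; apply/mapP; exists p.2; last by case: p {pN pp}.
by rewrite mem_iota.
Qed.

Lemma positions_prefix M N : M <= N -> exists s, positions N = positions M ++ s.
Proof.
move=> MN; exists (flatten [seq [seq (T, j) | j <- iota 0 T.+1] | T <- iota M (N - M)]).
by rewrite -flatten_cat -map_cat -iotaD subnKC.
Qed.

Definition before (p q : nat * nat) := (p.1 < q.1) || ((p.1 == q.1) && (p.2 < q.2)).

Lemma positions_pairwise N : pairwise before (positions N).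
Proof.
elim: N => // N IH; have -> : positions N.+1 = positions N ++ map (pair N) (iota 0 N.+1).
  by rewrite /positions -[in LHS]addn1 iotaD map_cat flatten_cat /= cats0.
rewrite pairwise_cat IH pairwise_map; apply/and3P; split=> //.
  apply/allrelP => p q; rewrite mem_positions => /andP [pN _] /mapP [j _ ->].
  by rewrite /before /= pN.
have : pairwise ltn (iota 0 N.+1).
  by rewrite -sorted_pairwise ?iota_ltn_sorted //; apply: ltn_trans.
by apply: sub_pairwise => i j; rewrite /before /= ltnn eqxx.
Qed.

Lemma positions_split N I1 p I2 q : positions N = I1 ++ p :: I2 ->
  q \in positions N -> before q p -> q \in I1.
Proof.
move=> PE; have := positions_pairwise N; rewrite PE mem_cat.
rewrite pairwise_cat pairwise_cons => /and3P [_ _ /andP [/allP pI2 _]].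
move=> /orP [//|]; rewrite inE => /orP [/eqP ->|/pI2].
  by rewrite /before ltnn eqxx ltnn.
by rewrite /before; case: ltngtP => //= _; case: ltngtP.
Qed.

Section Letters.
Variables (n : nat) (c : rat -> 'I_n).

(* Letters [0] and [1] say on which side of a cut [q] lies; the letters [i.+2]
   mark an ended [q] of colour [i]. *)
Definition letter (q : rat) (p : nat * nat) : nat :=
  if end_time q <= p.1 then (c q).+2 else beyond p.2 q.

Definition column (s : seq rat) (p : nat * nat) := [seq letter x p | x <- s].

(** Times [0] and [1] are the cuts with all rationals on one side; they account for the constant
    columns. *)
Definition events (s : seq rat) := [:: 0, 1 & code s].

Lemma crossing (T : Type) (a : pred T) x s : ~~ a x -> has a s ->
  exists s1 y s2, [/\ s = s1 ++ y :: s2, ~~ a (last x s1) & a y].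
Proof.
elim: s x => //= y s IH x ax; have [ay _|ay /= /(IH y ay)] := boolP (a y).
  by exists [::], y, s.
by move=> [s1 [z [s2 [-> s1a az]]]]; exists (y :: s1), z, s2.
Qed.

Lemma path_last (x z : rat) s : path (fun x y : rat => (x < y)%R) x s ->
  z \in x :: s -> (z <= last x s)%R.
Proof.
elim: s x z => [|y s IH] x z /=; first by rewrite inE => _ /eqP ->.
move=> /andP [xy ys]; rewrite inE => /orP [/eqP ->|/IH]; last exact.
by apply: ltW; apply: lt_le_trans xy (IH y y ys (mem_head _ _)).
Qed.

(** If the cut separates two neighbours, their split time is a cut with the same effect and not
    later; otherwise one of the trivial cuts [0] and [1] serves. *)
Lemma same_cut x s j : path (fun x y : rat => (x < y)%R) x s ->
  exists j', [/\ j' \in events (x :: s), j' <= j &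
    forall z, z \in x :: s -> beyond j' z = beyond j z].
Proof.
move=> xs; have [bx|bx] := boolP (beyond j x).
  exists 1; split; rewrite ?inE //; first by case: j bx.
  by move=> z /(path_le xs) xz; rewrite (beyond_le xz bx).
have [bs|bs] := boolP (has (beyond j) s); last first.
  exists 0; split; rewrite ?inE // => z; rewrite inE.
  move=> /orP [/eqP ->|zs]; first by rewrite (negPf bx).
  by apply/esym/negbTE; apply: contra bs => bz; apply/hasP; exists z.
have [s1 [y [s2 [sE b1 b2]]]] := crossing bx bs.
move: xs; rewrite sE cat_path /= => /and3P [xs1 xy ys2].
have [t1 t2] := beyond_split_time xy.
exists (split_time (last x s1) y); split.
- by rewrite /events /code code_from_cat !inE mem_cat mem_head !orbT.
- exact: split_time_le.
move=> z; rewrite -cat_cons mem_cat => /orP [zx|zy]; last first.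
  have yz := path_le ys2 zy.
  by rewrite (beyond_le yz t1) (beyond_le yz b2).
have zl := path_last xs1 zx.
by rewrite (negbTE (contra (beyond_le zl) t2)) (negbTE (contra (beyond_le zl) b1)).
Qed.

Lemma greatest_le (b : seq nat) T : 0 \in b ->
  exists T', [/\ T' \in b, T' <= T & forall t, t \in b -> t <= T -> t <= T'].
Proof.
elim: T => [|T IH] b0.
  by exists 0; split=> // t _; rewrite leqn0 => /eqP ->.
have [Tb|Tb] := boolP (T.+1 \in b); first by exists T.+1; split.
have [T' [T'b T'T H]] := IH b0; exists T'; split=> //; first exact: leqW.
move=> t tb; rewrite leq_eqVlt ltnS => /orP [/eqP tT|]; last exact: H.
by rewrite -tT tb in Tb.
Qed.

Lemma end_time_code z x s : z \in x :: s -> end_time z \in code_from x s.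
Proof.
elim: s x => [|y s IH] x /=; first by rewrite !inE => /eqP ->.
by rewrite inE => /orP [/eqP ->|/IH zs]; rewrite !inE ?eqxx // zs !orbT.
Qed.

(** Replacing [T] by the last event not after it, and [j] by the event given by [same_cut], leads to
    a position listed earlier with the same column; so positions outside the events show nothing
    new. *)
Lemma firsts_column x s N : path (fun x y : rat => (x < y)%R) x s ->
  let b := events (x :: s) in
  firsts (map (column (x :: s)) (positions N)) =
  firsts (map (column (x :: s)) [seq p <- positions N | (p.1 \in b) && (p.2 \in b)]).
Proof.
move=> xs b; apply: firsts_filter => I1 [T j] I2 PE /= nkeep.
have [T' [T'b T'T T'max]] := @greatest_le b T (mem_head _ _).
have [j' [j'b j'j j'P]] := same_cut j xs.
have : (T, j) \in positions N by rewrite PE mem_cat mem_head orbT.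
rewrite mem_positions /= => /andP [TN jT].
have j'T' : j' <= T' by apply: T'max => //; apply: leq_trans jT.
have colE : column (x :: s) (T', j') = column (x :: s) (T, j).
  apply/eq_in_map => z zs; rewrite /letter [_.1]/= [_.2]/= j'P //.
  have -> // : (end_time z <= T') = (end_time z <= T).
  have zb : end_time z \in b by rewrite 2!inE [_ \in code _]end_time_code ?orbT.
  by apply/idP/idP => [/leq_trans -> //|]; apply: T'max.
exists (T', j'); last by rewrite T'b j'b.
apply: positions_split PE _ _; first by rewrite mem_positions /= j'T' (leq_ltn_trans T'T).
rewrite /before /=; move: T'T; rewrite leq_eqVlt => /orP [/eqP TE|-> //].
rewrite TE eqxx ltnn /=; move: j'j; rewrite leq_eqVlt => /orP [/eqP jE|//].
by move: nkeep; rewrite -TE -jE T'b j'b.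
Qed.

Lemma mem_zip_code x s x' s' p : size s = size s' ->
  p \in zip (x :: s) (x' :: s') ->
  (end_time p.1, end_time p.2) \in zip (code_from x s) (code_from x' s').
Proof.
elim: s s' x x' => [|y s IH] [|y' s'] x x' //= => [_|[ss]].
  by rewrite !inE => /eqP ->.
rewrite inE => /orP [/eqP ->|/(IH _ _ _ ss) H]; first exact: mem_head.
by rewrite !inE H !orbT.
Qed.

(** An end time has no member beyond it, and a split time exactly those to its right; so the answer
    depends only on the places in the code and in the tuple. *)
Lemma beyond_zip_code x s x' s' p q :
  path (fun x y : rat => (x < y)%R) x s -> path (fun x y : rat => (x < y)%R) x' s' ->
  size s = size s' -> p \in zip (code_from x s) (code_from x' s') ->
  q \in zip (x :: s) (x' :: s') -> beyond p.1 q.1 = beyond p.2 q.2.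
Proof.
elim: s s' x x' => [|y s IH] [|y' s'] x x' //=.
  by rewrite !inE => _ _ _ /eqP -> /=; rewrite !beyond_end_time.
move=> /andP [xy ys] /andP [xy' ys'] [ss].
rewrite ![p \in _]in_cons => /or3P [/eqP ->|/eqP ->|pz]; first by rewrite !beyond_end_time.
  have [t1 t2] := beyond_split_time xy; have [t1' t2'] := beyond_split_time xy'.
  rewrite inE => /orP [/eqP -> /=|]; first by rewrite (negPf t2) (negPf t2').
  move=> qz; have [q1 q2] := @mem_zip _ _ (y :: s) (y' :: s') q qz.
  by rewrite /= (beyond_le (path_le ys q1) t1) (beyond_le (path_le ys' q2) t1').
rewrite inE => /orP [/eqP -> /=|]; last exact: IH.
have [p1 p2] := mem_zip pz.
have [_ b1 _] := mem_code_from ys p1; have [_ b2 _] := mem_code_from ys' p2.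
by rewrite (negbTE (contra (beyond_le (ltW xy)) b1)) (negbTE (contra (beyond_le (ltW xy')) b2)).
Qed.

Lemma filter_positions (b : seq nat) N :
  let B := [seq v <- iota 0 N | v \in b] in
  [seq p <- positions N | (p.1 \in b) && (p.2 \in b)] =
  flatten [seq [seq (T, j) | j <- [seq j <- B | j <= T]] | T <- B].
Proof.
move=> B; rewrite /positions filter_flatten -map_comp.
have rowE T : T \in b -> T < N -> [seq p <- [seq (T, j) | j <- iota 0 T.+1] |
    (p.1 \in b) && (p.2 \in b)] = [seq (T, j) | j <- [seq j <- B | j <= T]].
  move=> Tb TN; rewrite filter_map; congr map.
  rewrite /B -(subnKC TN) iotaD !filter_cat -[LHS]cats0; congr (_ ++ _).
    rewrite -filter_predI; apply/eq_in_filter => j; rewrite mem_iota add0n ltnS /=.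
    by rewrite Tb => ->.
  apply/esym/eqP; rewrite -(negbK (_ == _)) -has_filter; apply/hasPn => j.
  by rewrite mem_filter mem_iota -ltnNge => /andP [_ /andP []].
have flatten_filter (F G : nat -> seq (nat * nat)) L :
    (forall T, T \in L -> F T = if T \in b then G T else [::]) ->
    flatten (map F L) = flatten (map G [seq v <- L | v \in b]).
  elim: L => //= T L IH FG; rewrite FG ?mem_head // IH; first by case: ifP.
  by move=> v vL; apply: FG; rewrite inE vL orbT.
apply: flatten_filter => T; rewrite mem_iota => /andP [_ TN]; case: ifP => Tb; first exact: rowE.
apply/eqP; rewrite -(negbK (_ == _)) -has_filter.
by apply/hasPn => p /mapP [j _ ->] /=; rewrite Tb.
Qed.

Lemma eq_map_zip (T U S : eqType) (f : T -> S) (g : U -> S) s t : size s = size t ->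
  (forall p, p \in zip s t -> f p.1 = g p.2) -> map f s = map g t.
Proof.
elim: s t => [|x s IH] [|y t] //= [st] H; rewrite (H (x, y)) ?mem_head //.
by rewrite (IH t) // => p pz; apply: H; rewrite inE pz orbT.
Qed.

Lemma eq_map_mem_zip (T U S : eqType) (f : T -> S) (g : U -> S) s t p :
  map f s = map g t -> p \in zip s t -> f p.1 = g p.2.
Proof.
elim: s t => [|x s IH] [|y t] //= [xy st]; rewrite inE => /orP [/eqP -> //|].
exact: IH.
Qed.

(** The order isomorphism [phi] between the two sets of events carries event positions to event
    positions, in the same order and with the same columns. *)
Lemma firsts_matrix x s x' s' N N' :
  path (fun x y : rat => (x < y)%R) x s -> path (fun x y : rat => (x < y)%R) x' s' ->
  map c (x :: s) = map c (x' :: s') ->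
  same_order (code (x :: s)) (code (x' :: s')) ->
  all (gtn N) (events (x :: s)) -> all (gtn N') (events (x' :: s')) ->
  firsts (map (column (x :: s)) (positions N)) =
  firsts (map (column (x' :: s')) (positions N')).
Proof.
move=> xs xs' cE so /allP bN /allP bN'; rewrite !firsts_column // !filter_positions.
have ss : size s = size s' by have := congr1 size cE; rewrite /= !size_map => -[].
set b := events (x :: s) in bN *; set b' := events (x' :: s') in bN' *.
have code_gt1 y t : path (fun x y : rat => (x < y)%R) y t -> all (ltn 1) (code_from y t).
  by move=> yt; apply/allP => v /(mem_code_from yt) [].
have ub y t : path (fun x y : rat => (x < y)%R) y t -> uniq (events (y :: t)).
  move=> yt; rewrite /events /= inE /= code_from_uniq // andbT.
  by apply/andP; split; apply/negP => /(allP (code_gt1 _ _ yt)).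
have sb : size b = size b' by rewrite /= !size_code_from ss.
have sob : same_order b b'.
  have gt0 y t : path (fun x y : rat => (x < y)%R) y t -> all (ltn 0) (1 :: code_from y t).
    by move=> /code_gt1 yt; rewrite /= (sub_all _ yt) // => v /=; apply: ltnW.
  have g0 := gt0 _ _ xs; have g0' := gt0 _ _ xs'.
  have so1 := @same_order_insert [::] _ [::] _ 1 1 erefl so (code_gt1 _ _ xs) (code_gt1 _ _ xs').
  exact: (@same_order_insert [::] _ [::] _ 0 0 erefl so1 g0 g0').
pose phi v := nth 0 b' (index v b).
have phi_zip v : v \in b -> (v, phi v) \in zip b b'.
  move=> vb; have := mem_nth (0, 0) (_ : index v b < size (zip b b')).
  by rewrite size_zip -sb minnn index_mem vb nth_zip // nth_index // => /(_ isT).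
have phi_le u v : u \in b -> v \in b -> (phi u <= phi v) = (u <= v).
  by move=> /phi_zip ub' /phi_zip vb'; rewrite (sob _ _ ub' vb').
have phi_mem v : v \in b -> phi v \in b' by move=> /phi_zip /mem_zip [].
have phi_surj v' : v' \in b' -> exists2 v, v \in b & phi v = v'.
  move=> vb'; have ib : index v' b' < size b by rewrite sb index_mem.
  exists (nth 0 b (index v' b')); first exact: mem_nth.
  by rewrite /phi index_uniq ?ub // nth_index.
have BE : [seq v <- iota 0 N' | v \in b'] = map phi [seq v <- iota 0 N | v \in b].
  apply: (irr_sorted_eq ltn_trans ltnn).
  - by apply: sorted_filter; [exact: ltn_trans|exact: iota_ltn_sorted].
  - apply: (@homo_sorted_in _ _ (mem b) phi ltn ltn).
    + by move=> u v ub' vb' /=; rewrite !ltnNge phi_le.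
    + by apply/allP => v; rewrite mem_filter => /andP [].
    + by apply: sorted_filter; [exact: ltn_trans|exact: iota_ltn_sorted].
  - move=> v'; rewrite mem_filter mem_iota; apply/andP/mapP => [[/phi_surj [v vb <-] _]|[v]].
      by exists v; rewrite // mem_filter vb mem_iota; exact: bN.
    by rewrite mem_filter => /andP [vb _] ->; split; [|apply: bN']; exact: phi_mem.
have colE T j : T \in b -> j \in b ->
    column (x :: s) (T, j) = column (x' :: s') (phi T, phi j).
  move=> Tb jb; apply: eq_map_zip => [|p pz]; first by rewrite /= ss.
  rewrite /letter [_.1 in X in _ <= X]/= [(T, j).2]/=.
  have pc := eq_map_mem_zip cE pz.
  have pe : (end_time p.1, end_time p.2) \in zip b b'.
    by have := mem_zip_code ss pz; rewrite /= !inE => ->; rewrite !orbT.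
  rewrite (sob _ _ pe (phi_zip _ Tb)) /= pc; case: ifP => // _; congr nat_of_bool.
  have := phi_zip _ jb; rewrite /= !inE => /or3P [/eqP [-> ->] //|/eqP [-> ->] //|jz].
  exact: (beyond_zip_code xs xs' ss jz pz).
rewrite BE !map_flatten -!map_comp; congr (firsts (flatten _)).
apply/eq_in_map => T; rewrite mem_filter => /andP [Tb _] /=.
rewrite filter_map -!map_comp.
rewrite (@eq_in_filter _ (preim phi (fun j => j <= phi T)) (fun j => j <= T)); last first.
  by move=> j; rewrite mem_filter => /andP [jb _] /=; apply: phi_le.
by apply/eq_in_map => j; rewrite !mem_filter => /and3P [_ jb _]; apply: colE.
Qed.

End Letters.
End Matrices.

(** * The upper bound *)

Section UpperBound.
Local Open Scope nat_scope.

Fixpoint word_lt (s t : seq nat) : bool :=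
  match s, t with
  | _, [::] => false
  | [::], _ => true
  | x :: s', y :: t' => (x < y) || ((x == y) && word_lt s' t')
  end.

Lemma word_lt_irr : irreflexive word_lt.
Proof. by elim=> //= x s ->; rewrite ltnn eqxx. Qed.

Lemma word_lt_trans : transitive word_lt.
Proof.
elim=> [|y t IH] [|x s] [|z u] //=.
case: (ltngtP x y) => //= [xy|->]; last by case: ltngtP => //= _; apply: IH.
by case: (ltngtP y z) => //= [yz|<-]; rewrite ?(ltn_trans xy yz) // xy.
Qed.

Lemma word_lt_cat p x y s t : x < y -> word_lt (p ++ x :: s) (p ++ y :: t).
Proof. by move=> xy; elim: p => /= [|z p ->]; rewrite ?xy // eqxx orbT. Qed.

(** Cutting after the first end mark makes the result independent of how many further stages are
    read. *)
Definition truncate (w : seq nat) := take (find (leq 2) w).+1 w.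

Lemma truncate_cat u v : has (leq 2) u -> truncate (u ++ v) = truncate u.
Proof.
move=> hu; rewrite /truncate find_cat hu takel_cat //.
by move: hu; rewrite has_find.
Qed.

Lemma truncate_catr u v : ~~ has (leq 2) u -> truncate (u ++ v) = u ++ truncate v.
Proof. by move=> hu; rewrite /truncate find_cat (negPf hu) -addnS takeD take_size_cat // drop_size_cat. Qed.

Lemma truncate_has w : has (leq 2) w -> 2 <= nth 0 (truncate w) (find (leq 2) (truncate w)) /\
  nth 0 (truncate w) (find (leq 2) (truncate w)) \in w.
Proof.
move=> hw; have ht : has (leq 2) (truncate w).
  have fw : find (leq 2) w < size w by rewrite -has_find.
  apply/hasP; exists (nth 0 w (find (leq 2) w)); last exact: nth_find.
  rewrite /truncate (take_nth 0) // mem_rcons mem_head //.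
split; first exact: nth_find.
by apply: (mem_take (n0 := (find (leq 2) w).+1)); apply: mem_nth; rewrite -has_find.
Qed.

Variables (n : nat) (c : rat -> 'I_n) (n0 : 0 < n).

Definition word_color (w : seq nat) : 'I_n :=
  odflt (Ordinal n0) (insub (nth 0 w (find (leq 2) w)).-2).

Definition word (q : rat) := [seq letter c q p | p <- positions (end_time q).+1].

Lemma word_prefix q N : end_time q < N ->
  exists s, [seq letter c q p | p <- positions N] = word q ++ s.
Proof.
move=> /positions_prefix [s ->]; exists [seq letter c q p | p <- s].
by rewrite map_cat.
Qed.

Lemma word_has q : has (leq 2) (word q).
Proof.
apply/hasP; exists (c q).+2 => //; apply/mapP; exists (end_time q, 0).
  by rewrite mem_positions [_.1]/fst ltnSn.
by rewrite /letter [_.1]/fst leqnn.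
Qed.

Lemma mem_word q i : i \in word q -> 2 <= i -> i = (c q).+2.
Proof.
move=> /mapP [p _ ->]; rewrite /letter; case: ifP => // _.
by case: (beyond _ _).
Qed.

(** With [j] the split time, the common part [p] stops just before position [(j, j)], where cut [j]
    is first read. Both rationals end later, so no end mark precedes it. *)
Lemma word_split x y : (x < y)%R -> exists p s t,
  [/\ word x = rcons p 0 ++ s, word y = rcons p 1 ++ t & ~~ has (leq 2) p].
Proof.
move=> xy; set j := split_time x y.
have jx : j < end_time x := split_time_lt_end xy.
have jy : j < end_time y := split_time_lt_end_right xy.
have [b1 b2] := beyond_split_time xy.
pose I := positions j ++ [seq (j, i) | i <- iota 0 j].
have PE : positions j.+1 = rcons I (j, j).
  rewrite /positions -[in LHS]addn1 iotaD map_cat flatten_cat -/(positions j).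
  rewrite /I -cats1 -catA; congr (_ ++ _).
  by rewrite [LHS]cats0 add0n -[in LHS]addn1 iotaD map_cat.
have I_lt p : p \in I -> p.1 <= j /\ p.2 < j.
  rewrite mem_cat => /orP [|/mapP [i]]; last by rewrite mem_iota => /andP [_ ij] ->.
  rewrite mem_positions => /andP [pj pp]; split; first exact: ltnW.
  exact: leq_ltn_trans pp pj.
have lE p : p \in I -> letter c x p = letter c y p.
  move=> /I_lt [p1 p2]; rewrite /letter leqNgt (leq_ltn_trans p1 jx).
  rewrite [_ <= _]leqNgt (leq_ltn_trans p1 jy); congr nat_of_bool; apply/idP/idP; first exact: (beyond_le (ltW xy)).
  by move=> py; apply: contraLR p2 => px; rewrite -leqNgt; apply: split_time_le.
have wE q : j < end_time q -> exists s, word q =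
    rcons [seq letter c q p | p <- I] (beyond j q) ++ s.
  move=> jq; have [s sE] := positions_prefix (leqW jq : j.+1 <= (end_time q).+1).
  exists [seq letter c q p | p <- s].
  by rewrite /word sE map_cat PE map_rcons [letter _ _ (j, j)]/letter leqNgt jq.
have [s sE] := wE x jx; have [t tE] := wE y jy.
exists [seq letter c x p | p <- I], s, t; split.
- by rewrite sE (negPf b2).
- by rewrite tE b1; congr (rcons _ _ ++ _); apply/eq_in_map => p /lE ->.
- apply/hasPn => i /mapP [p /I_lt [p1 p2] ->].
  by rewrite /letter [end_time x <= _]leqNgt (leq_ltn_trans p1 jx); case: (beyond _ _).
Qed.

Section Substitution.
Variables (V : nat -> seq nat) (rV : rigid V).

Definition subst_word q := truncate (app 0 V (word q)).

Lemma app_word_has q : has (leq 2) (app 0 V (word q)).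
Proof.
by have /hasP [i iw i2] := word_has q; apply/hasP; exists i; rewrite ?mem_app.
Qed.

Lemma subst_word_color q : word_color (subst_word q) = c q.
Proof.
have [t2 tw] := truncate_has (app_word_has q); rewrite mem_app // in tw.
by rewrite /word_color /subst_word (mem_word tw t2) /= valK.
Qed.

(** A rigid substitution keeps the common beginning common, with the differing letters [0] and [1]
    directly after it; the truncation falls later. *)
Lemma subst_word_lt x y : (x < y)%R -> word_lt (subst_word x) (subst_word y).
Proof.
move=> /word_split [p [s [t [xE yE p2]]]]; rewrite /subst_word xE yE.
have [s1 ->] := app_cat rV 0 (rcons p 0) s; have [t1 ->] := app_cat rV 0 (rcons p 1) t.
have [s2 ->] := app_rcons rV 0 p 0; have [t2 ->] := app_rcons rV 0 p 1.
have nh i : i < 2 -> ~~ has (leq 2) (rcons (app 0 V p) i).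
  move=> i2; rewrite has_rcons negb_or -ltnNge i2 /=.
  by apply: contra p2 => /hasP [k]; rewrite mem_app // => kp k2; apply/hasP; exists k.
rewrite -!catA (truncate_catr _ (nh 0 isT)) (truncate_catr _ (nh 1 isT)).
by rewrite !cat_rcons word_lt_cat.
Qed.

Lemma subst_word_positions q N : end_time q < N ->
  truncate (app 0 V [seq letter c q p | p <- positions N]) = subst_word q.
Proof.
move=> /word_prefix [s ->]; have [t ->] := app_cat rV 0 (word q) s.
exact: truncate_cat (app_word_has q).
Qed.

End Substitution.

Notation increasing := (sorted (fun x y : rat => (x < y)%R)).

Lemma ltn_big_max (s : seq nat) : all (gtn (\max_(i <- s) i).+1) s.
Proof. by apply/allP => v vs; rewrite /= ltnS; apply: leq_bigmax_seq. Qed.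

Lemma firsts_history (X : Pn n) h : exists p, forall s N,
  0 < size s -> increasing s -> map c s = X -> history_of [:: code s] h ->
  all (gtn N) (events s) ->
  firsts [seq column c s q | q <- positions N] = p.
Proof.
pose ok s N := [/\ 0 < size s, increasing s, map c s = X, history_of [:: code s] h &
  all (gtn N) (events s)].
have [[s0 [N0 [s00 s0i s0X s0h s0N]]]|none] := pselect (exists s N, ok s N); last first.
  by exists [::] => s N ? ? ? ? ?; case: none; exists s, N.
exists (firsts [seq column c s0 q | q <- positions N0]) => s N s_0 si sX sh sN.
case: s s_0 si sX sh sN => // x s _ xs sX sh sN.
case: s0 s00 s0i s0X s0h s0N => // x0 s0 _ xs0 s0X s0h s0N.
apply: firsts_matrix => //; first by rewrite sX s0X.
by have [_] := history_of_order sh s0h; rewrite /= !cats0.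
Qed.

Lemma increasing_reflect (f : rat -> rat) s : (forall x y : rat, (x < y)%R -> (f x < f y)%R) ->
  increasing (map f s) -> increasing s.
Proof.
move=> fm; rewrite sorted_map; apply: sub_sorted => x y /= fxy.
by rewrite ltNge; apply/negP; rewrite le_eqVlt => /orP [/eqP yx|/fm yx];
   move: fxy; rewrite ?yx ?ltxx // ltNge (ltW yx).
Qed.

Lemma firsts_index (T : eqType) (s : seq T) :
  firsts [seq index x (firsts s) | x <- s] = iota 0 (size (firsts s)).
Proof.
rewrite (@firsts_map_inj _ _ (fun x => index x (firsts s))); last first.
  move=> x y xs ys /(congr1 (fun i => nth x (firsts s) i)).
  by rewrite !nth_index ?mem_firsts.
case E : (firsts s) => [//|x0 s1]; rewrite -{}E.
apply: (@eq_from_nth _ 0); rewrite size_map ?size_iota // => i ip.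
by rewrite (nth_map x0) // nth_iota // index_uniq ?firsts_uniq.
Qed.

Theorem upper_bound (X : Pn n) : dense_partition c -> 0 < size X ->
  big_ramsey_bound c X (histories_count (2 * size X - 1) 1).
Proof.
move=> cd X0 k k0 chi; rewrite -size_histories.
set H := histories _ _.
have [e [e_lt e_color]] :=
  @colored_embedding (seq nat) n c word_lt word_color n0 cd word_lt_irr word_lt_trans.
have [pat patP] := choice (firsts_history X).
pose rows (w : seq (seq nat)) := [seq [seq nth 0 r l | r <- w] | l <- iota 0 (size X)].
(* A word [t] over column numbers is decoded, for every history at once, into a matrix whose rows
   are turned into rationals and coloured by [chi]. *)
pose chi' (t : seq nat) : {ffun 'I_(size H) -> 'I_k} :=
  [ffun i : 'I_(size H) =>
    chi [seq e (truncate w) | w <- rows [seq nth [::] (pat (nth [::] H i)) j | j <- t]]].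
have [V [col [rV VP]]] := dual_ramsey_lt (\max_(i < size H) size (pat (nth [::] H i))).+1 chi'.
pose f q := e (subst_word V q).
have f_lt x y : (x < y)%R -> (f x < f y)%R by move=> xy; apply/e_lt/subst_word_lt.
exists f; split; first by split=> // x; rewrite /f e_color subst_word_color.
exists [set col (size (pat (nth [::] H i))) i | i : 'I_(size H)]; split.
  by apply: leq_trans (leq_imset_card _ _) _; rewrite card_ord.
move=> s [si sX] /allP sf.
have [s0 sE] : exists s0, s = map f s0.
  elim: s sf {si sX} => [|x s IH] sf; first by exists [::].
  have [|s0 ->] := IH; first by move=> y ys; apply: sf; rewrite inE ys orbT.
  have := sf x (mem_head _ _); rewrite inE => -[y _ <-].
  by exists (y :: s0).
have s0X : map c s0 = X.
  by rewrite -sX sE -map_comp; apply/eq_map => q /=; rewrite /f e_color subst_word_color.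
have s0i : increasing s0 by apply: increasing_reflect f_lt _; rewrite -sE.
have s00 : 0 < size s0 by rewrite -(size_map c) s0X.
have W0 : [::] \notin [:: s0] by rewrite inE eq_sym -size_eq0 -lt0n.
have incW : increasing (flatten [:: s0]) by rewrite /= cats0.
have [h hP] := codes_history W0 incW.
have hH : h \in H.
  have := mem_histories hP; rewrite /= cats0 size_code /H.
  by rewrite -subn1 -s0X size_map.
have iH : index h H < size H by rewrite index_mem.
pose i := Ordinal iH; have hi : nth [::] H i = h by rewrite nth_index.
have N_events := ltn_big_max (events s0); set N := (\max_(v <- _) v).+1 in N_events.
pose M := [seq column c s0 q | q <- positions N].
have patE : firsts M = pat h by apply: patP.
(* The matrix of [s0] with each column replaced by its number in order of first occurrence, the form
   to which the dual Ramsey theorem applies. *)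
pose t := [seq index r (pat h) | r <- M].
have t_firsts : firsts t = iota 0 (size (pat h)) by rewrite /t -patE firsts_index.
suff <- : chi' (app 0 V t) i = chi s.
  rewrite (VP (size (pat h)) t) //; last first.
    rewrite ltnS -hi.
    exact: (leq_bigmax (F := fun j : 'I_(size H) => size (pat (nth [::] H j))) i).
  by apply/imsetP; exists i; rewrite // hi.
rewrite ffunE hi -(app_map rV 0 [::]) /t -map_comp.
have -> : map (nth [::] (pat h) \o index^~ (pat h)) M = M.
  rewrite -[RHS]map_id; apply/eq_in_map => r rM /=.
  by rewrite nth_index // -patE mem_firsts.
congr chi; rewrite /rows -map_comp sE.
have sz : size X = size s0 by rewrite -s0X size_map.
have s0E : s0 = [seq nth 0%R s0 l | l <- iota 0 (size s0)].
  by rewrite map_nth_iota0 // take_size.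
rewrite sz [in RHS]s0E -!map_comp; apply/eq_in_map => l; rewrite mem_iota => /andP [_ ls] /=.
congr e; have Nl : end_time (nth 0%R s0 l) < N.
  apply: (allP N_events); rewrite !inE [_ \in code s0](_ : _ = true) ?orbT //.
  have := mem_nth 0%R ls; case: (s0) => // x s1; exact: end_time_code.
rewrite -(subst_word_positions rV Nl) -(app_map rV [::] 0); congr (truncate (app _ _ _)).
rewrite -map_comp; apply/eq_map => q /=.
by rewrite /column (nth_map 0%R).
Qed.

End UpperBound.

(** * The lower bound *)

Section LowerBound.
Local Open Scope nat_scope.
Notation increasing := (sorted (fun x y : rat => (x < y)%R)).
Variables (n : nat) (c : rat -> 'I_n) (cd : dense_partition c).

Section Realization.
Variable f : rat -> rat.
Hypothesis f_lt : forall x y : rat, (x < y)%R -> (f x < f y)%R.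

Definition inside (i : rat * rat) (x : rat) := (i.1 < x < i.2)%R.

Lemma embedding_le (x y : rat) : (x <= y)%R -> (f x <= f y)%R.
Proof. by rewrite le_eqVlt => /orP [/eqP ->|/f_lt /ltW]. Qed.

Lemma embedding_inj : injective f.
Proof. by move=> x y fxy; case: (ltgtP x y) => // /f_lt; rewrite fxy ltxx. Qed.

(** Each further time costs two halvings: one puts all images on the same side of the cut, the other
    avoids the only point whose image could end then. *)
Lemma quiet_interval (R : nat) (i : rat * rat) : (i.1 < i.2)%R ->
  exists i' : rat * rat, [/\ (i'.1 < i'.2)%R, forall x, inside i' x -> inside i x &
    forall j, j < R ->
      (forall x, inside i' x -> end_time (f x) != j) /\
      (forall x y, inside i' x -> inside i' y -> beyond j (f x) = beyond j (f y))].
Proof.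
move=> i_lt; elim: R => [|R [[u v] [/= uv sub quiet]]]; first by exists i; split.
have mid (a b : rat) : (a < b)%R -> (a < (a + b) / 2 < b)%R.
  by move=> ab; rewrite (midf_lt ab).1 (midf_lt ab).2.
have [u1 [v1 [uv1 sub1 cut1]]] : exists u1 v1, [/\ (u1 < v1)%R,
    forall x, inside (u1, v1) x -> inside (u, v) x &
    forall x y, inside (u1, v1) x -> inside (u1, v1) y -> beyond R (f x) = beyond R (f y)].
  have /andP [uw wv] := mid u v uv; set w := ((u + v) / 2)%R in uw wv.
  have [bw|bw] := boolP (beyond R (f w)).
    exists w, v; split=> // [x /andP [/= wx xv]|x y /andP [/= wx _] /andP [/= wy _]].
      by rewrite /inside /= xv (lt_trans uw wx).
    by rewrite !(beyond_le (embedding_le (ltW _)) bw).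
  exists u, w; split=> // [x /andP [/= ux xw]|x y /andP [/= _ xw] /andP [/= _ yw]].
    by rewrite /inside /= ux (lt_trans xw wv).
  by rewrite !(negbTE (contra (beyond_le (embedding_le (ltW _))) bw)).
have [u2 [v2 [uv2 sub2 end2]]] : exists u2 v2, [/\ (u2 < v2)%R,
    forall x, inside (u2, v2) x -> inside (u1, v1) x &
    forall x, inside (u2, v2) x -> end_time (f x) != R].
  have /andP [uw wv] := mid u1 v1 uv1; set w := ((u1 + v1) / 2)%R in uw wv.
  have [[z zw zR]|nz] := pselect (exists2 z, (z <= w)%R & end_time (f z) = R).
    exists w, v1; split=> // x /andP [/= wx xv].
      by rewrite /inside /= xv (lt_trans uw wx).
    apply/eqP; rewrite -zR => /end_time_inj /embedding_inj xz.
    by move: wx; rewrite xz ltNge zw.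
  exists u1, w; split=> // x /andP [/= ux xw].
    by rewrite /inside /= ux (lt_trans xw wv).
  by apply/eqP => xR; apply: nz; exists x => //; apply: ltW.
exists (u2, v2); split=> // [x /sub2/sub1/sub //|j].
rewrite ltnS leq_eqVlt => /orP [/eqP ->|/quiet [q1 q2]].
  by split=> // x y /sub2 x1 /sub2; exact: cut1.
by split=> [x /sub2/sub1/q1 //|x y /sub2/sub1 x1 /sub2/sub1]; exact: q2.
Qed.

Lemma end_in_interval (R : nat) (i : rat * rat) (a : 'I_n) : (i.1 < i.2)%R ->
  exists x, [/\ inside i x, c x = a & R <= end_time (f x)].
Proof.
move=> /(quiet_interval R) [i' [i'lt sub quiet]].
have [x [ux [xv cx]]] := cd a i'lt.
have xi : inside i' x by rewrite /inside ux.
exists x; split=> //; first exact: sub.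
by rewrite leqNgt; apply/negP => /quiet [/(_ x xi)]; rewrite eqxx.
Qed.

(** [t] is the least cut separating the images of two points [x0], [y0] of a quiet interval. Points
    left of [x0] and right of [y0] have images split exactly at [t]: this cut still separates them,
    and no earlier one does. *)
Lemma split_in_interval (R : nat) (i : rat * rat) : (i.1 < i.2)%R ->
  exists i1 i2 t, [/\ (i1.1 < i1.2)%R && (i2.1 < i2.2)%R,
    forall x, inside i1 x -> inside i x, forall x, inside i2 x -> inside i x,
    R <= t &
    forall x y, inside i1 x -> inside i2 y -> (x < y)%R /\ split_time (f x) (f y) = t].
Proof.
move=> /(quiet_interval R) [[u v] [/= uv sub quiet]].
pose sep j := `[< exists x y, [/\ inside (u, v) x, inside (u, v) y,
  ~~ beyond j (f x) & beyond j (f y)] >].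
have sep_lt j x y : ~~ beyond j (f x) -> beyond j (f y) -> (x < y)%R.
  by move=> bx b_y; rewrite ltNge; apply: contra bx => /embedding_le /beyond_le; apply.
have ex_sep : exists j, sep j.
  have [x [ux [xv _]]] := cd (c 0%R) uv; have [y [xy [yv _]]] := cd (c 0%R) xv.
  have [b1 b2] := beyond_split_time (f_lt xy).
  exists (split_time (f x) (f y)); apply/asboolP; exists x, y.
  split=> //; first by rewrite /inside ux.
  by rewrite /inside yv (lt_trans ux xy).
have [t sep_t tmin] : exists2 t, sep t & forall j, sep j -> t <= j.
  by case: (ex_minnP ex_sep) => t; exists t.
move/asboolP: (sep_t) => [x0 [y0 [/andP [/= ux0 x0v] /andP [/= uy0 y0v] bx b_y]]].
have xy := sep_lt _ _ _ bx b_y.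
have in1 x : inside (u, x0) x -> inside (u, v) x.
  by move=> /andP [/= ux xx]; rewrite /inside /= ux (lt_trans xx x0v).
have in2 x : inside (y0, v) x -> inside (u, v) x.
  by move=> /andP [/= yx xv]; rewrite /inside /= xv (lt_trans uy0 yx).
exists (u, x0), (y0, v), t; split.
- by rewrite ux0 y0v.
- by move=> x /in1/sub.
- by move=> x /in2/sub.
- rewrite leqNgt; apply/negP => /quiet [_ /(_ x0 y0)].
  by rewrite /inside /= ux0 x0v uy0 y0v (negPf bx) b_y => /(_ isT isT).
move=> x y x1 y2; move: (x1) (y2) => /andP [/= ux xx0] /andP [/= y0y yv].
have xy' : (x < y)%R by apply: lt_trans xx0 (lt_trans xy y0y).
split=> //; apply/eqP; rewrite eqn_leq; apply/andP; split.
  apply: (split_time_le (f_lt xy')).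
    exact: (beyond_le (embedding_le (ltW y0y)) b_y).
  exact: (contra (beyond_le (embedding_le (ltW xx0))) bx).
apply: tmin; apply/asboolP; exists x, y.
by have [? ?] := beyond_split_time (f_lt xy'); split; [apply: in1|apply: in2| |].
Qed.

Definition fcode s := code (map f s).

Definition fits (i : rat * rat) (s : seq rat) :=
  [/\ s != [::], increasing s & all (inside i) s].

Lemma split_at (T : Type) (s : seq T) i : i < size s ->
  exists a x b, s = a ++ x :: b /\ size a = i.
Proof.
case: s => // x0 s is_; exists (take i (x0 :: s)), (nth x0 (x0 :: s) i), (drop i.+1 (x0 :: s)).
by rewrite -drop_nth // cat_take_drop size_takel // ltnW.
Qed.

Lemma map_eq_cat (T U : Type) (g : T -> U) s a b : map g s = a ++ b ->
  exists a' b', [/\ s = a' ++ b', map g a' = a & map g b' = b].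
Proof.
move=> sE; exists (take (size a) s), (drop (size a) s).
by rewrite cat_take_drop map_take map_drop sE take_size_cat // drop_size_cat.
Qed.

Lemma map_eq_cons (T U : Type) (g : T -> U) s x b : map g s = x :: b ->
  exists x' b', [/\ s = x' :: b', g x' = x & map g b' = b].
Proof. by case: s => // y s [<- <-]; exists y, s. Qed.

(** Induction from the first step of the history on. The bound [R] puts the remaining events after
    the present one, and [I] allows the intervals to shrink. The equation for [sumn sh] sums over
    the cells the count of [2 m - 1] events for a cell of size [m]. *)
Lemma realize (N k : nat) h : h \in histories N k ->
  exists sh : seq nat, [/\ size sh = k, 2 * sumn sh = N + k &
    forall (XX : seq (seq 'I_n)) (R : nat) (I : seq (rat * rat)),
      map size XX = sh -> size I = k -> all (fun i => i.1 < i.2)%R I ->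
      exists W : seq (seq rat), [/\ map (map c) W = XX,
        history_of (map fcode W) h, all (leq R) (flatten (map fcode W)) &
        forall p, p \in zip I W -> fits p.1 p.2]].
Proof.
elim: N k h => [|N IH] k h /=.
  case: eqP => // -> ; rewrite inE => /eqP ->; exists [::]; split=> // XX R I.
  case: XX => // _ /size0nil -> _; exists [::]; split=> //; first exact: HistoryNil.
rewrite mem_cat => /orP [] /allpairsP [[i h'] /= [ik /IH [sh' [ss sumE real]] ->]];
  rewrite mem_iota add0n /= in ik.
- have [sA [a [sB [shE sAi]]]] : exists sA a sB, sh' = sA ++ a :: sB /\ size sA = i.
    by apply: split_at; rewrite ss leqW.
  have [b [sB' sBE]] : exists b sB', sB = b :: sB'.
    case: sB shE => [shE|b sB' _]; last by exists b, sB'.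
    by move: ss ik; rewrite shE size_cat /= sAi; lia.
  exists (sA ++ (a + b) :: sB'); split.
  - by move: ss; rewrite shE sBE !size_cat /=; lia.
  - by move: sumE; rewrite shE sBE !sumn_cat /=; lia.
  move=> XX R I XXs sI Ilt.
  have [XA [XB' [-> XAs XBs']]] := map_eq_cat XXs.
  have [g [XB [-> gs XBs]]] := map_eq_cons XBs'.
  have [IA [u [IB [IE IAi]]]] : exists IA u IB, I = IA ++ u :: IB /\ size IA = i.
    by apply: split_at; rewrite sI.
  move: Ilt; rewrite IE all_cat /= => /and3P [IAlt ult IBlt].
  (* The cell is split at a time [t] not before [R]; its halves are then realised in [u1] and [u2]
     with all their events after [t]. *)
  have [u1 [u2 [t [/andP [u1lt u2lt] sub1 sub2 Rt tE]]]] := split_in_interval R ult.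
  have [||| W' [W'X W'h W'R W'f]] :=
      real (XA ++ take a g :: drop a g :: XB) t.+1 (IA ++ u1 :: u2 :: IB).
  - rewrite map_cat /= XAs XBs size_takel ?size_drop ?gs ?leq_addr // addKn shE sBE //.
  - by move: sI; rewrite IE !size_cat /=; lia.
  - by rewrite all_cat /= IAlt u1lt u2lt.
  have [WA [W2 [W'E WAX W2X]]] := map_eq_cat W'X.
  have [s1 [W3 [W2E s1X W3X]]] := map_eq_cons W2X.
  have [s2 [WB [W3E s2X WBX]]] := map_eq_cons W3X.
  move: W'h W'R W'f; rewrite {}W'E {}W2E {}W3E => W'h W'R W'f.
  have WAi : size WA = i by rewrite -(size_map (map c)) WAX -(size_map size) XAs.
  have zE : zip (IA ++ u1 :: u2 :: IB) (WA ++ s1 :: s2 :: WB) =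
      zip IA WA ++ (u1, s1) :: (u2, s2) :: zip IB WB by rewrite zip_cat ?IAi.
  rewrite {}zE in W'f.
  have [s10 s1i /allP s1u] : fits u1 s1.
    by apply: (W'f (u1, s1)); rewrite mem_cat mem_head orbT.
  have [s20 s2i /allP s2u] : fits u2 s2.
    by apply: (W'f (u2, s2)); rewrite mem_cat !inE eqxx !orbT.
  have codeE : fcode (s1 ++ s2) = fcode s1 ++ t :: fcode s2.
    case: s1 s2 s10 s20 s1u s2u {s1i s2i s1X s2X W'h W'R W'f} => // x s1 [//|y s2] _ _ s1u s2u.
    rewrite /fcode map_cat /= code_from_cat last_map.
    by have [_ ->] := tE _ _ (s1u _ (mem_last x s1)) (s2u _ (mem_head y s2)).
  exists (WA ++ (s1 ++ s2) :: WB); split.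
  - by rewrite map_cat /= WAX WBX map_cat s1X s2X cat_take_drop.
  - rewrite map_cat /= codeE -WAi -(size_map fcode); apply: HistorySplit.
      by rewrite map_cat /= in W'h.
    by rewrite map_cat /= in W'R.
  - move: W'R; rewrite !map_cat !flatten_cat /= codeE !all_cat /= Rt.
    have lR (s : seq nat) : all (leq t.+1) s -> all (leq R) s.
      by apply: sub_all => m /= /ltnW; apply: leq_trans.
    by case/and4P => /lR -> /lR -> /lR -> /lR ->.
  - move=> p; rewrite zip_cat ?IAi // mem_cat inE => pW.
    have : p = (u, s1 ++ s2) \/ p \in zip IA WA ++ (u1, s1) :: (u2, s2) :: zip IB WB.
      by rewrite mem_cat !inE; case/or3P: pW => [->|/eqP ->|->]; rewrite ?orbT; auto.
    case=> [->|]; last exact: W'f.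
    split=> /=; first by rewrite -size_eq0 size_cat addn_eq0 negb_and !size_eq0 s10.
      case: s1 s10 s1i s1u {s1X W'h W'R W'f codeE pW} => // x s1 _ /= s1i s1u.
      case: s2 s20 s2i s2u {s2X} => // y s2 _ /= s2i s2u.
      rewrite cat_path s1i /= s2i andbT.
      by have [] := tE _ _ (s1u _ (mem_last x s1)) (s2u _ (mem_head y s2)).
    rewrite all_cat; apply/andP; split; apply/allP => x; first by move=> /s1u/sub1.
    by move=> /s2u/sub2.
- have [sA [sB [shE sAi]]] : exists sA sB, sh' = sA ++ sB /\ size sA = i.
    exists (take i sh'), (drop i sh'); rewrite cat_take_drop size_takel // ss; lia.
  exists (sA ++ 1 :: sB); split.
  - by move: ss; rewrite shE !size_cat /=; lia.
  - by move: sumE; rewrite shE !sumn_cat /=; lia.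
  move=> XX R I XXs sI Ilt.
  have [XA [XB' [-> XAs XBs']]] := map_eq_cat XXs.
  have [g [XB [-> gs XBs]]] := map_eq_cons XBs'.
  have [a ga] : exists a, g = [:: a] by case: g gs => [|a []] //; exists a.
  have [IA [u [IB [IE IAi]]]] : exists IA u IB, I = IA ++ u :: IB /\ size IA = i.
    by apply: split_at; rewrite sI.
  move: Ilt; rewrite IE all_cat /= => /and3P [IAlt ult IBlt].
  have [x [xu xa xR]] := end_in_interval R a ult.
  have [||| W' [W'X W'h W'R W'f]] := real (XA ++ XB) (end_time (f x)).+1 (IA ++ IB).
  - by rewrite map_cat XAs XBs.
  - by move: sI; rewrite IE !size_cat /=; lia.
  - by rewrite all_cat IAlt.
  have [WA [WB [W'E WAX WBX]]] := map_eq_cat W'X.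
  move: W'h W'R W'f; rewrite {}W'E => W'h W'R W'f.
  have WAi : size WA = i by rewrite -(size_map (map c)) WAX -(size_map size) XAs.
  rewrite zip_cat ?IAi // in W'f.
  exists (WA ++ [:: x] :: WB); split.
  - by rewrite map_cat /= WAX WBX xa ga.
  - rewrite map_cat /= -WAi -(size_map fcode); apply: HistoryEnd.
      by rewrite map_cat in W'h.
    by rewrite map_cat in W'R.
  - move: W'R; rewrite !map_cat !flatten_cat /= !all_cat /= xR.
    have lR (s : seq nat) : all (leq (end_time (f x)).+1) s -> all (leq R) s.
      by apply: sub_all => m /= /ltnW; apply: leq_trans.
    by case/andP => /lR -> /lR ->.
  - move=> p; rewrite zip_cat ?IAi // mem_cat inE => /or3P [pA|/eqP ->|pB].
    + by apply: W'f; rewrite mem_cat pA.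
    + by split=> //=; rewrite xu.
    + by apply: W'f; rewrite mem_cat pB orbT.
Qed.

End Realization.

Theorem lower_bound (X : Pn n) (L : nat) : 0 < size X -> big_ramsey_bound c X L ->
  histories_count (2 * size X - 1) 1 <= L.
Proof.
move=> X0; rewrite -size_histories; set H := histories _ _.
have [->//|H0] := posnP (size H).
have ex_hist (s : seq rat) : exists h, forall h', history_of [:: code s] h' -> h' = h.
  have [[h hP]|nh] := pselect (exists h, history_of [:: code s] h).
    by exists h => h' /history_of_inj; apply.
  by exists [::] => h' h'P; case: nh; exists h'.
have [hist histP] := choice ex_hist.
(* The colour is the place of the history in [H]; the default only serves lists whose history is not
   in [H]. *)
pose chi s : 'I_(size H) := odflt (Ordinal H0) (insub (index (hist s) H)).
move=> /(_ _ H0 chi) [f [[f_lt f_color] [V [VL VP]]]].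
suff VT : [set: 'I_(size H)] \subset V.
  by apply: leq_trans VL; rewrite -{1}(card_ord (size H)) -cardsT subset_leq_card.
apply/fintype.subsetP => i _.
have hH : nth [::] H i \in histories (2 * size X - 1) 1 by apply: mem_nth.
have [sh [ss sumE real]] := realize f_lt hH.
case: sh ss sumE real => [|m []] //= _ mE real.
(* There is a single cell, placed in the unit interval; the equation for [sh] forces its size [m] to
   be [size X]. *)
have [|||W [WX Wh _ Wf]] := real [:: X] 0 [:: (0%R, 1%R)] => //.
  by rewrite /=; congr [:: _]; lia.
case: W WX Wh Wf => [|s0 []] //= [sX] Wh /(_ _ (mem_head _ _)) [_ /= si _].
have <- : chi (map f s0) = i.
  rewrite /chi -(histP _ _ Wh) index_uniq ?histories_uniq //.
  by rewrite valK.
apply: VP.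
  split; first by apply: homo_sorted si => x y; apply: f_lt.
  by rewrite -sX -map_comp; apply/eq_map => x /=; rewrite f_color.
by apply/allP => _ /mapP [x _ ->]; rewrite inE; exists x.
Qed.

End LowerBound.

Theorem theorem3 (R : realType) (n : nat) (c : rat -> 'I_n) (X : Pn n) :
  (0 < n)%N -> dense_partition c -> (0 < size X)%N ->
  exists L : nat,
    derive1n (2 * size X - 1) (@tan R) 0 = L%:R /\ big_ramsey_degree_is c X L.
Proof.
move=> n0 cd X0; exists (histories_count (2 * size X - 1) 1).
split; first exact: derive1n_tan0.
by split=> [|L]; [exact: upper_bound|exact: lower_bound].
Qed.
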